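(* There is a universal constant $C>0$ such that for every $n\ge 2$, every $A\in\mathbb{R}^{m\times n}$ with $\mathrm{rk}(A)=m$ and every $b\in\mathbb{R}^m$, the circuit diameter of the polyhedron $P=\{x\in\mathbb{R}^n: Ax=b,\ x\ge\mathbf 0\}$ is at most $$C\,n^2\log(n)\ \sup_{c}\ \sum_{i=1}^n \mathrm{SLC}_{1/2}(x^{\mathfrak m}_i),$$ where the supremum is over all $c\in\mathbb{R}^n$ for which the max central path $x^{\mathfrak m}$ of the linear program $\min\{\langle c,x\rangle:x\in P\}$ is well defined.
   Context: Circuits: an elementary vector of $A$ is a vector $h\in\ker(A)\setminus\{\mathbf 0\}$ of inclusion-minimal support among nonzero vectors of $\ker(A)$; $\mathcal E(A)$ is the set of elementary vectors. A circuit walk is a sequence $x^{(0)},\dots,x^{(T)}$ in $P$ with $x^{(t+1)}=x^{(t)}+\alpha h$ for some $h\in\mathcal E(A)$, where $\alpha>0$ is the maximal step size with $x^{(t)}+\alpha h\in P$; its length is $T$. The circuit diameter of $P$ is the maximum, over all ordered pairs of vertices $(u,v)$ of $P$, of the length of a shortest circuit walk from $u$ to $v$. Max central path: for $c\in\mathbb{R}^n$ such that $\min\{\langle c,x\rangle:x\in P\}$ has finite optimal value $v^*$ and all sublevel sets $P_g=\{x\in P:\langle c,x\rangle\le v^*+g\}$, $g\ge0$, are bounded, define $x^{\mathfrak m}_i(g)=\max\{x_i:x\in P_g\}$ for $i\in[n]$, $g\ge0$. Straight line complexity: for $\phi:\mathbb{R}_{\ge0}\to\mathbb{R}_{\ge0}$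 and $\eta\in(0,1]$, $\mathrm{SLC}_\eta(\phi)$ is the minimum number of pieces of a continuous piecewise linear function $\psi:\mathbb{R}_{\ge0}\to\mathbb{R}_{\ge0}$ with $\eta\phi\le\psi\le\phi$. *)

(* Defs.v *)
From HB Require Import structures.
From mathcomp Require Import all_boot all_order all_algebra.
From mathcomp Require Import all_classical all_reals all_analysis.

Set Implicit Arguments.
Unset Strict Implicit.
Unset Printing Implicit Defensive.

Import Order.TTheory GRing.Theory Num.Theory.
Import numFieldNormedType.Exports.

Local Open Scope classical_set_scope.
Local Open Scope ring_scope.

Section Polyhedron.
Context {R : realType} {m n : nat}.
Implicit Types (A : 'M[R]_(m, n)) (b : 'cV[R]_m) (c u v x y h : 'cV[R]_n).

Definition inner c x : R := \sum_(i < n) c i 0 * x i 0.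

Definition polyhedron A b : set 'cV[R]_n :=
  [set x | A *m x = b /\ forall i, 0 <= x i 0].

(* Vertices are the extreme points. *)
Definition is_vertex (P : set 'cV[R]_n) x :=
  P x /\ forall y z (t : R), P y -> P z -> 0 < t < 1 ->
    x = t *: y + (1 - t) *: z -> y = x /\ z = x.

Definition vsupp h : {set 'I_n} := [set i | h i 0 != 0]%SET.

Definition elementary A : set 'cV[R]_n :=
  [set h | [/\ A *m h = 0, h != 0 &
    forall y, A *m y = 0 -> y != 0 -> ~~ (vsupp y \proper vsupp h)]].

Definition circuit_step A b x y :=
  exists (h : 'cV[R]_n) (alpha : R),
    [/\ elementary A h, 0 < alpha, y = x + alpha *: h,
        polyhedron A b y &
        forall beta : R, polyhedron A b (x + beta *: h) -> beta <= alpha].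

Definition circuit_walk A b (T : nat) u v :=
  exists x : nat -> 'cV[R]_n,
    [/\ x 0%N = u, x T = v,
        forall t, (t <= T)%N -> polyhedron A b (x t) &
        forall t, (t < T)%N -> circuit_step A b (x t) (x t.+1)].

(* +oo if there is no circuit walk from u to v. *)
Definition circuit_dist A b u v : \bar R :=
  ereal_inf [set (T%:R : R)%:E | T in [set T | circuit_walk A b T u v]].

(* Supremum over the finite set of ordered pairs of vertices; -oo exactly when
   there is no vertex, that is, when the polyhedron is empty. *)
Definition circuit_diameter A b : \bar R :=
  ereal_sup [set circuit_dist A b p.1 p.2 |
    p in [set p : 'cV[R]_n * 'cV[R]_n |
      is_vertex (polyhedron A b) p.1 /\ is_vertex (polyhedron A b) p.2]].

Definition lp_value A b c : R := inf [set inner c x | x in polyhedron A b].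

Definition sublevel A b c (g : R) : set 'cV[R]_n :=
  [set x | polyhedron A b x /\ inner c x <= lp_value A b c + g].

(* [has_inf] expresses feasibility and boundedness from below, that is,
   finiteness of the optimal value. *)
Definition max_central_path_defined A b c :=
  has_inf [set inner c x | x in polyhedron A b] /\
  forall g : R, 0 <= g -> bounded_set (sublevel A b c g).

(* When [max_central_path_defined A b c] and [0 <= g], the sublevel set is
   nonempty and compact, so that this [sup] is an attained maximum. *)
Definition max_central_path A b c (i : 'I_n) (g : R) : R :=
  sup [set x i 0 | x in sublevel A b c g].

End Polyhedron.

Section StraightLineComplexity.
Context {R : realType}.
Implicit Types (phi psi : R -> R).

(* Functions on the nonnegative reals are represented by functions R -> R whose
   values at negative arguments are irrelevant. The pieces are [t 0, t 1], ...,
   [t (k-2), t (k-1)] and the unbounded [t (k-1), +oo[, with t 0 = 0. *)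
Definition piecewise_linear (k : nat) psi :=
  [/\ (0 < k)%N,
      {within [set g : R | 0 <= g], continuous psi} &
      exists t : nat -> R,
        [/\ t 0%N = 0,
            forall j, (j.+1 < k)%N -> t j < t j.+1 &
            forall j, (j < k)%N -> exists a d : R, forall g : R,
              t j <= g -> ((j.+1 < k)%N -> g <= t j.+1) -> psi g = a * g + d]].

(* +oo if no function with finitely many pieces fits. *)
Definition SLC (eta : R) phi : \bar R :=
  ereal_inf [set (k%:R : R)%:E | k in [set k | exists psi,
    [/\ piecewise_linear k psi,
        forall g, 0 <= g -> 0 <= psi g &
        forall g, 0 <= g -> eta * phi g <= psi g <= phi g]]].

End StraightLineComplexity.

(* Main.v *)
Require Import Defs.
From HB Require Import structures.
From mathcomp Require Import all_boot all_order all_algebra.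
From mathcomp Require Import all_classical all_reals all_analysis.
From mathcomp Require Import zify ring lra.

Set Implicit Arguments.
Unset Strict Implicit.
Unset Printing Implicit Defensive.

Import Order.TTheory GRing.Theory Num.Theory.
Import numFieldNormedType.Exports.

Local Open Scope classical_set_scope.
Local Open Scope ring_scope.

(* Given a target vertex v, minimize c = the indicator of {i | v_i = 0}: then c >= 0,
   v is the only feasible point of gap 0, and the sublevel sets are bounded.
   Following the circuit of a conformal decomposition of v - x that improves the
   gap most divides the gap by G = n^O(n) in O(n^2 log n) steps, so it suffices
   to bypass all but O(sum of the SLCs) of the gaps g_0, g_0/G, g_0/G^2, ...

   Away from the breakpoints of the piecewise linear approximations, each x^m_i
   is, up to a factor 4, either proportional to the gap (i in N) or constant
   (i not in N). Let D be the largest dimension of a space of kernel vectors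
   whose part outside N is dominated by its part in N, both being measured
   relatively to x^m. While D does not change, every x near the top of a range
   of gaps admits a feasible w with w >= (1 - 1/4n) x outside N and with w
   small on N. An augmentation along a circuit of w - x which decreases a large
   coordinate in N substantially can only be blocked in N, by a coordinate
   which is large, so n augmentations lead to the bottom of the range. Along
   decreasing gaps D grows, except that it drops by at most one for each
   coordinate whose type changes; hence it changes O(sum of the SLCs) times.

   The resulting number of steps does not depend on the gap to be reached, and
   only finitely many points can be reached in that many steps, so gap 0, that
   is v, is reached. *)

(** * Conformal circuits *)

Section Conformal.
Context {R : realType} {m n : nat}.
Implicit Types (A : 'M[R]_(m, n)) (d h p x y : 'cV[R]_n).

Lemma innerD p x y : inner p (x + y) = inner p x + inner p y.
Proof. by rewrite /inner -big_split; apply: eq_bigr => i _; rewrite mxE mulrDr. Qed.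

Lemma innerZ p (a : R) x : inner p (a *: x) = a * inner p x.
Proof. by rewrite /inner mulr_sumr; apply: eq_bigr => i _; rewrite mxE mulrCA. Qed.

Lemma inner0 p : inner p 0 = 0.
Proof. by rewrite /inner big1 // => i _; rewrite mxE mulr0. Qed.

Lemma innerB p x y : inner p (x - y) = inner p x - inner p y.
Proof. by rewrite innerD -scaleN1r innerZ mulN1r. Qed.

Lemma inner_sum p (hs : seq 'cV[R]_n) :
  inner p (\sum_(h <- hs) h) = \sum_(h <- hs) inner p h.
Proof.
elim: hs => [|h hs IH]; first by rewrite !big_nil inner0.
by rewrite !big_cons innerD IH.
Qed.

Lemma inner_delta i x : inner (delta_mx i 0) x = x i 0 :> R.
Proof.
rewrite /inner (bigD1 i) //= big1 ?addr0 ?mxE ?eqxx ?mul1r // => j /negPf ji.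
by rewrite mxE ji mul0r.
Qed.

Definition same_sign h d :=
  forall i, 0 <= h i 0 * d i 0 /\ (d i 0 = 0 -> h i 0 = 0).

(** Stronger than [same_sign] in that it also bounds the size: whenever [x] and [x + d] are
    nonnegative, so is [x + h]. *)
Definition conformal h d :=
  forall i, 0 <= h i 0 <= d i 0 \/ d i 0 <= h i 0 <= 0.

Lemma vsuppPn (d : 'cV[R]_n) i : reflect (d i 0 = 0) (i \notin vsupp d).
Proof. by rewrite inE negbK; apply: eqP. Qed.

Lemma nonzero_entry (d : 'cV[R]_n) : d != 0 -> exists i, d i 0 != 0.
Proof.
move=> d0; apply/existsP; apply: contraNT d0; rewrite negb_exists => /forallP H.
by apply/eqP/matrixP => i j; rewrite !mxE ord1; apply/eqP; move: (H i); rewrite negbK.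
Qed.

Lemma elementaryZ A h (a : R) : a != 0 -> elementary A h -> elementary A (a *: h).
Proof.
move=> a0 [Ah h0 hmin]; split.
- by rewrite -scalemxAr Ah scaler0.
- by rewrite scaler_eq0 negb_or a0.
- have -> : vsupp (a *: h) = vsupp h.
    by apply/setP => i; rewrite !inE mxE mulf_eq0 negb_or a0.
  exact: hmin.
Qed.

(** Induction on the support. If [d] is not elementary, subtract a kernel vector [y] of smaller
    support, scaled so that a coordinate of [d] vanishes and none changes sign. *)
Lemma same_sign_elementary A d : A *m d = 0 -> d != 0 ->
  exists2 h, elementary A h & same_sign h d.
Proof.
have [k] := ubnP #|vsupp d|; elim: k d => // k IH d dk Ad d0.
have [dE|] := pselect (elementary A d).
  by exists d => // i; split => //; rewrite -expr2 sqr_ge0.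
move=> dNE.
have [y [Ay y0 yd]] : exists y, [/\ A *m y = 0, y != 0 & vsupp y \proper vsupp d].
  apply: contrapT => H; apply: dNE; split => // y Ay y0; apply/negP => yd.
  by apply: H; exists y.
(* Up to replacing [y] by [- y], some coordinate has the same sign in [y] and in [d]. *)
wlog [i yi] : y Ay y0 yd / exists i, 0 < y i 0 * d i 0.
  move=> W; have [i yi] := nonzero_entry y0.
  have di : d i 0 != 0.
    by have := fintype.subsetP (proper_sub yd) i; rewrite !inE; apply.
  have : y i 0 * d i 0 != 0 by rewrite mulf_neq0.
  rewrite neq_lt => /orP[lt0|gt0]; last by apply: (W y) => //; exists i.
  apply: (W (- y)).
  - by rewrite mulmxN Ay oppr0.
  - by rewrite oppr_eq0.
  - rewrite (_ : vsupp (- y) = vsupp y) //.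
    by apply/setP => j; rewrite !inE mxE oppr_eq0.
  - by exists i; rewrite mxE mulNr oppr_gt0.
pose Q := [pred j | 0 < y j 0 * d j 0].
have Qi : Q i by [].
case: (Order.TotalTheory.arg_minP (fun j => d j 0 / y j 0) Qi) => j Qj jmin.
set t := d j 0 / y j 0 in jmin.
have yj0 : y j 0 != 0 by apply/eqP => yj; move: Qj; rewrite /= yj mul0r ltxx.
pose d' : 'cV[R]_n := d - t *: y.
have d'E l : d' l 0 = d l 0 - t * y l 0 by rewrite !mxE.
have t0 : 0 < t.
  rewrite (_ : t = y j 0 * d j 0 / y j 0 ^+ 2); last by rewrite /t; field.
  by rewrite divr_gt0 // lt_neqAle sqr_ge0 eq_sym sqrf_eq0 yj0.
have d'd l : 0 <= d' l 0 * d l 0.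
  rewrite d'E mulrBl subr_ge0.
  have [Ql|] := boolP (Q l); last first.
    by rewrite /= -leNgt => H; rewrite -mulrA; apply: (le_trans (y := 0)); [rewrite pmulr_rle0|rewrite -expr2 sqr_ge0].
  have yl0 : y l 0 != 0 by apply/eqP => yl; move: Ql; rewrite /= yl mul0r ltxx.
  have := jmin l Ql; move: Ql => /= Ql tl.
  have -> : d l 0 * d l 0 = d l 0 / y l 0 * (y l 0 * d l 0) by field.
  by rewrite -[t * _ * _]mulrA ler_pM2r.
have d'0 l : d l 0 = 0 -> d' l 0 = 0.
  move=> dl; rewrite d'E dl.
  have /vsuppPn -> : l \notin vsupp y.
    by apply: contra (fintype.subsetP (proper_sub yd) l) _; apply/vsuppPn.
  by rewrite mulr0 subr0.
have [h hE hd'] : exists2 h, elementary A h & same_sign h d'.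
  apply: IH.
  - apply: (@leq_trans #|vsupp d|); last by rewrite -ltnS.
    apply: proper_card.
    apply/properP; split.
      apply/fintype.subsetP => l; rewrite !inE; apply: contra => /eqP dl.
      by rewrite d'0.
    exists j; rewrite inE; last by rewrite negbK d'E /t divfK // subrr.
    by apply/eqP => dj; move: Qj; rewrite /= dj mulr0 ltxx.
  - by rewrite mulmxBr -scalemxAr Ay Ad scaler0 subr0.
  - have /properP[_ [l ld /vsuppPn ly]] := yd.
    apply/eqP => E; move: ld; rewrite inE.
    by move: (d'E l); rewrite E mxE ly mulr0 subr0 => <-; rewrite eqxx.
exists h => // l; have [h1 h2] := hd' l; split; last by move=> /d'0.
have [/eqP /h2 ->|d'l] := boolP (d' l 0 == 0); first by rewrite mul0r.
rewrite -(pmulr_lge0 _ (x := d' l 0 ^+ 2)); last by rewrite lt_neqAle sqr_ge0 eq_sym sqrf_eq0 d'l.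
rewrite (_ : h l 0 * d l 0 * _ = (h l 0 * d' l 0) * (d' l 0 * d l 0)); last by ring.
by rewrite mulr_ge0.
Qed.

(** A sign-compatible circuit is scaled until it first meets [d] in some coordinate; that coordinate
    disappears from the support of [d - h]. *)
Lemma conformal_elementary A d : A *m d = 0 -> d != 0 ->
  exists h, [/\ elementary A h, conformal h d & exists2 i, d i 0 != 0 & h i 0 = d i 0].
Proof.
move=> Ad d0; have [h hE hd] := same_sign_elementary Ad d0.
have [i hi] : exists i, h i 0 != 0 by case: hE => _ /nonzero_entry.
pose Q := [pred j | h j 0 != 0].
have Qi : Q i by [].
case: (Order.TotalTheory.arg_minP (fun j => d j 0 / h j 0) Qi) => j Qj jmin.
have dn l : h l 0 != 0 -> d l 0 != 0 by apply: contra => /eqP /(proj2 (hd l)) ->.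
have hd0 l : h l 0 != 0 -> 0 < h l 0 * d l 0.
  by move=> hl; rewrite lt_neqAle (proj1 (hd l)) eq_sym mulf_neq0 // dn.
have hj : h j 0 != 0 := Qj.
set s := d j 0 / h j 0 in jmin.
have s0 : 0 < s.
  rewrite (_ : s = h j 0 * d j 0 / h j 0 ^+ 2); last by rewrite /s; field.
  by rewrite divr_gt0 ?hd0 // lt_neqAle sqr_ge0 eq_sym sqrf_eq0 hj.
exists (s *: h); split.
- by apply: elementaryZ => //; rewrite gt_eqF.
- move=> l; rewrite mxE.
  have [->|hl] := eqVneq (h l 0) 0.
    by rewrite mulr0 lexx /= andbT; apply/orP; rewrite le_total.
  have := jmin l hl; have := hd0 l hl.
  case: (ltgtP (h l 0) 0) hl => // hl _ hdl.
    rewrite ler_ndivlMr // => ?; right; apply/andP; split=> //.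
    by rewrite pmulr_rle0 // ltW.
  rewrite ler_pdivlMr // => ?; left; apply/andP; split=> //.
  by rewrite pmulr_rge0 // ltW.
- by exists j; [exact: dn|rewrite mxE /s divfK].
Qed.

(** Each circuit subtracted removes a coordinate from the support, so at most [n] are needed; what
    is conformal to [d - h] is conformal to [d]. *)
Lemma conformal_decomposition A d : A *m d = 0 ->
  exists hs : seq 'cV[R]_n, [/\ (size hs <= n)%N,
    forall h, h \in hs -> elementary A h /\ conformal h d & d = \sum_(h <- hs) h].
Proof.
move=> Ad.
suff [hs [H1 H2 H3]] : exists hs : seq 'cV[R]_n, [/\ (size hs <= #|vsupp d|)%N,
    forall h, h \in hs -> elementary A h /\ conformal h d & d = \sum_(h <- hs) h].
  exists hs; split => //; apply: (leq_trans H1).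
  by apply: leq_trans (max_card _) _; rewrite card_ord.
have [k] := ubnP #|vsupp d|; elim: k d Ad => // k IH d Ad dk.
have [->|d0] := eqVneq d 0; first by exists [::]; rewrite big_nil.
have [h [hE hd [i di hi]]] := conformal_elementary Ad d0.
have sub : vsupp (d - h) \proper vsupp d.
  apply/properP; split; last by exists i; rewrite !inE ?mxE ?hi ?subrr ?eqxx.
  apply/fintype.subsetP => l; rewrite !inE !mxE; apply: contra => /eqP dl.
  by case: (hd l); rewrite dl => /le_anti <-; rewrite subrr.
have [||hs [h1 h2 h3]] := IH (d - h).
- by rewrite mulmxBr Ad; case: hE => ->; rewrite subrr.
- by apply: leq_trans (proper_card sub) _.
exists (h :: hs); split.
- exact: leq_ltn_trans h1 (proper_card sub).
- move=> g; rewrite inE => /orP[/eqP -> //|/h2[gE gd]]; split => // l.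
  by have := gd l; have := hd l; rewrite !mxE; case=> /andP[? ?]; case=> /andP[? ?];
     (left; lra) || (right; lra).
- by rewrite big_cons -h3 addrC subrK.
Qed.

(** Averaging over a conformal decomposition; having fewer than [n] terms only helps, as [inner p d]
    is negative. *)
Lemma conformal_improvement A d p : A *m d = 0 -> inner p d < 0 ->
  exists h, [/\ elementary A h, conformal h d & inner p h <= inner p d / n%:R].
Proof.
move=> Ad pd; have [hs [hs1 hs2 hs3]] := conformal_decomposition Ad.
apply: contrapT => H.
have hs0 : hs != [::].
  by apply/eqP => hs0; move: pd; rewrite hs3 hs0 big_nil inner0 ltxx.
have n0 : (0 < n)%N by apply: leq_trans hs1; rewrite lt0n size_eq0.
have n0' : 0 < n%:R :> R by rewrite ltr0n.
have : \sum_(h <- hs) (inner p d / n%:R) < \sum_(h <- hs) inner p h.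
  have [h0 h0in] : exists h0, h0 \in hs.
    by case: hs hs0 {hs1 hs2 hs3} => // h0 ? _; exists h0; rewrite mem_head.
  rewrite !(big_rem h0 h0in) /=; apply: ltr_leD.
    have [hE hd] := hs2 _ h0in.
    by rewrite ltNge; apply/negP => hlt; apply: H; exists h0.
  rewrite !big_seq; apply: ler_sum => h /mem_rem hin; have [hE hd] := hs2 h hin.
  by rewrite leNgt; apply/negP => hlt; apply: H; exists h; split => //; exact: ltW.
rewrite -inner_sum -hs3 big_const_seq count_predT iter_addr addr0 => /lt_geF.
rewrite -(mulr_natr (_ / _)) => /negP; apply.
have q1 : (size hs)%:R / n%:R <= 1 :> R by rewrite ler_pdivrMr // mul1r ler_nat.
by rewrite -mulrA [_^-1 * _]mulrC; nra.
Qed.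

End Conformal.

(** * Circuit walks and the finiteness of what they reach *)

Section Walks.
Context {R : realType} {m n : nat} (A : 'M[R]_(m, n)) (b : 'cV[R]_m).
Implicit Types (x y z h : 'cV[R]_n).
Local Notation P := (polyhedron A b).

(** The ratio test: the blocking [j] minimizes [x j 0 / - h j 0] over the negative entries of [h],
    and feasibility of [x + h] makes this ratio at least 1. *)
Lemma maximal_step x h : P x -> P (x + h) -> elementary A h ->
  (exists i, h i 0 < 0) ->
  exists a, [/\ 1 <= a, circuit_step A b x (x + a *: h) &
    exists2 j, h j 0 < 0 & x j 0 + a * h j 0 = 0].
Proof.
move=> [Ax x0] [Axh xh0] hE [i hi].
pose Q := [pred j | h j 0 < 0].
have Qi : Q i by [].
case: (Order.TotalTheory.arg_minP (fun j => x j 0 / (- h j 0)) Qi) => j Qj jmin.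
have hj : h j 0 < 0 := Qj.
set a := x j 0 / _ in jmin.
have aE : x j 0 + a * h j 0 = 0 by rewrite /a; field; rewrite lt_eqF.
have a1 : 1 <= a.
  by rewrite /a ler_pdivlMr ?oppr_gt0 // mul1r; have := xh0 j; rewrite mxE; lra.
exists a; split => //; last by exists j.
exists h, a; split => //.
- exact: lt_le_trans ltr01 a1.
- split; first by rewrite mulmxDr -scalemxAr Ax; case: hE => -> _ _; rewrite scaler0 addr0.
  move=> l; rewrite !mxE; have [hl|hl] := ltP (h l 0) 0; last first.
    by rewrite addr_ge0 // mulr_ge0 // (le_trans _ a1).
  by have := jmin l hl; rewrite ler_pdivlMr ?oppr_gt0 //; lra.
- move=> be [_ /(_ j)]; rewrite !mxE => ?.
  by rewrite /a ler_pdivlMr ?oppr_gt0 //; lra.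
Qed.

(** At most [T] steps rather than exactly [T], so that bounds can be relaxed and composed. *)
Fixpoint reach T x y : Prop :=
  x = y \/ (if T is T'.+1 then exists2 z, circuit_step A b x z & reach T' z y else False).

Lemma reach_refl T x : reach T x x.
Proof. by case: T => [|T]; left. Qed.

Lemma reach_step x y : circuit_step A b x y -> reach 1 x y.
Proof. by move=> s; right; exists y => //; left. Qed.

Lemma reach_leq T1 T2 x y : (T1 <= T2)%N -> reach T1 x y -> reach T2 x y.
Proof.
elim: T1 T2 x => [|T1 IH] [|T2] x //=; first by move=> _ [->|//]; left.
by move=> le [->|[z xz zy]]; [left|right; exists z => //; exact: IH zy].
Qed.

Lemma reach_trans T1 T2 x y z : reach T1 x y -> reach T2 y z -> reach (T1 + T2) x z.
Proof.
elim: T1 x => [|T1 IH] x /=; first by case=> // ->.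
case=> [<-|[w xw wy]] yz; last by right; exists w => //; exact: IH.
by apply: (@reach_leq T2 (T1 + T2).+1) => //; rewrite leqW // leq_addl.
Qed.

Lemma reach_walk T x y : P x -> reach T x y ->
  exists2 T', (T' <= T)%N & circuit_walk A b T' x y.
Proof.
elim: T x => [|T IH] x Px /=.
  by case=> // <-; exists 0%N => //; exists (fun=> x); split.
case=> [<-|[z xz zy]]; first by exists 0%N => //; exists (fun=> x); split.
have Pz : P z by case: xz => [h [a []]].
have [T' TT' [w [w0 wT wP ws]]] := IH z Pz zy.
exists T'.+1 => //; exists (fun t => if t is t'.+1 then w t' else x); split => //.
- by case=> // t; exact: wP.
- by case=> [_|t]; [rewrite w0|exact: ws].
Qed.

(** Cancelling one coordinate of [h'] by a multiple of [h] leaves a kernel vector of strictly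
    smaller support, which must be 0. *)
Lemma elementary_proportional h h' : elementary A h -> elementary A h' ->
  vsupp h = vsupp h' -> exists2 t, t != 0 & h' = t *: h.
Proof.
move=> [Ah h0 hmin] [Ah' h'0 _] hh'.
have [i hi] := nonzero_entry h0.
have hi' : h' i 0 != 0 by move/setP: (hh') => /(_ i); rewrite !inE hi => <-.
exists (h' i 0 / h i 0); first by rewrite mulf_neq0 ?invr_eq0.
apply/eqP; rewrite -subr_eq0; apply/negPn/negP => d0.
have Ad : A *m (h' - h' i 0 / h i 0 *: h) = 0.
  by rewrite mulmxBr -scalemxAr Ah Ah' scaler0 subr0.
have /negP := hmin _ Ad d0; apply.
apply/properP; split; last first.
  by exists i; rewrite !inE ?hi // !mxE divfK // subrr eqxx.
apply/fintype.subsetP => l; rewrite [in X in _ -> X]hh' !inE !mxE.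
apply: contra => /eqP h'l.
have /vsuppPn -> : l \notin vsupp h by rewrite hh'; apply/vsuppPn.
by rewrite h'l mulr0 subr0.
Qed.

(** The support and the positive entries of [y - x] determine its circuit up to a positive factor;
    maximality then determines [y]. *)
Lemma circuit_step_finite x : finite_set [set y | circuit_step A b x y].
Proof.
pose code y := (vsupp (y - x), [set i | 0 < (y - x) i 0]%SET).
apply: (@sub_finite_set _ _ (\bigcup_(p in [set: {set 'I_n} * {set 'I_n}])
    [set y | circuit_step A b x y /\ code y = p])).
  by move=> y xy; exists (code y).
apply: bigcup_finite => // p _.
have [[y0 [s0 c0]]|H] := pselect (exists y, circuit_step A b x y /\ code y = p); last first.
  by apply: (sub_finite_set _ (finite_set0 _)) => y ?; apply: H; exists y.
apply: (sub_finite_set _ (finite_set1 y0)) => y [s c] /=.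
move: c0; rewrite -c => -[{c p}].
case: s0 => [h0 [a0 [h0E a00 -> P0 m0]]]; case: s => [h [a [hE a_0 -> Px mx]]].
rewrite ![x + _]addrC !addrK => sE gE.
have [t t0 hh] : exists2 t, t != 0 & h = t *: h0.
  apply: elementary_proportional => //; apply/setP => l.
  by move/setP: sE => /(_ l); rewrite !inE !mxE !mulf_eq0 (gt_eqF a00) (gt_eqF a_0).
have {t0} t0 : 0 < t.
  have [i hi] : exists i, h0 i 0 != 0 by case: h0E => _ /nonzero_entry.
  move/setP: gE => /(_ i); rewrite !inE hh !mxE (pmulr_rgt0 _ a00) (pmulr_rgt0 _ a_0).
  case: (ltgtP (h0 i 0) 0) hi => // hi _ e.
    rewrite lt_neqAle eq_sym t0 leNgt; apply/negP => tn.
    by move: e; rewrite nmulr_rgt0 // hi.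
  by rewrite -(pmulr_lgt0 _ hi) -e.
congr (_ + _); rewrite hh scalerA; congr (_ *: _); apply/le_anti/andP; split.
  by apply: m0; rewrite -scalerA -hh.
rewrite -ler_pdivrMr //; apply: mx.
by rewrite hh scalerA divfK // gt_eqF.
Qed.

Lemma reach_finite T x : finite_set [set y | reach T x y].
Proof.
elim: T x => [|T IH] x.
  by apply: (sub_finite_set _ (finite_set1 x)) => y /= [->|].
apply: (@sub_finite_set _ _ ([set x] `|`
   \bigcup_(z in [set z | circuit_step A b x z]) [set y | reach T z y])).
  by move=> y /= [->|[z xz zy]]; [left|right; exists z].
rewrite finite_setU; split => //.
by apply: bigcup_finite => // ; exact: circuit_step_finite.
Qed.

End Walks.

(** * Orthogonal projection onto a subspace *)

Section WeightedProjection.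
Context {R : realType} {n : nat}.
Implicit Types (a d e u : 'rV[R]_n) (om : 'I_n -> R).

Definition wdot om a d : R := \sum_i om i * a 0 i * d 0 i.

Lemma wdot_mx om a d : wdot om a d = (a *m diag_mx (\row_i om i) *m d^T) 0 0.
Proof.
rewrite mxE; apply: eq_bigr => i _.
by rewrite mul_mx_diag !mxE [a 0 i * _]mulrC.
Qed.

(** Weights may vanish, so definiteness is assumed on [V] only; it makes the Gram matrix [G] of a
    basis [M] of [V] invertible. *)
Lemma weighted_projection (V : 'M[R]_n) om a : (forall i, 0 <= om i) ->
  (forall d, (d <= V)%MS -> wdot om d d = 0 -> d = 0) ->
  exists2 u, (u <= V)%MS & forall d, (d <= V)%MS -> wdot om (a - u) d = 0.
Proof.
move=> om0 Vpos.
have [M [Mfree MV VM]] : exists M : 'M[R]_(\rank V, n),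
    [/\ row_free M, (M <= V)%MS & (V <= M)%MS].
  by exists (row_base V); rewrite row_base_free !eq_row_base.
pose D := diag_mx (\row_i om i); pose G := M *m D *m M^T.
have Gfree : row_free G.
  apply: inj_row_free => z zG.
  have : z *m M = 0.
    apply: Vpos; first exact: mulmx_sub.
    rewrite wdot_mx trmx_mul -/D (_ : _ *m D *m _ = z *m G *m z^T); last by rewrite !mulmxA.
    by rewrite zG mul0mx mxE.
  by move=> zM; apply: (row_free_inj Mfree); rewrite zM mul0mx.
have Gunit : G \in unitmx by rewrite -row_free_unit.
exists (a *m D *m M^T *m invmx G *m M); first exact: mulmx_sub.
move=> d dV; have /submxP[z ->] := submx_trans dV VM.
rewrite wdot_mx -/D trmx_mul !mulmxBl.
rewrite (_ : _ *m M *m D *m (M^T *m z^T) =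
  a *m D *m M^T *m (invmx G *m G) *m z^T); last by rewrite !mulmxA.
by rewrite mulVmx // mulmx1 !mulmxA subrr mxE.
Qed.

End WeightedProjection.

(** * Gaps and heights *)

Section MaxCentralPath.
Context {R : realType} {m n : nat} (A : 'M[R]_(m, n)) (b : 'cV[R]_m) (c v : 'cV[R]_n).
Implicit Types (x y z h : 'cV[R]_n).
Local Notation P := (polyhedron A b).

(** In this section the optimal value is 0, attained at [v]: [inner c x] is the gap of [x], and
    [height i] plays the role of the max central path. *)
Definition below (g : R) : set 'cV[R]_n := [set x | P x /\ inner c x <= g].
Definition height (i : 'I_n) (g : R) : R := sup [set x i 0 | x in below g].

Context (c_ge0 : forall i, 0 <= c i 0) (Pv : P v) (gap_v : inner c v = 0).
Context (below_ubound : forall g i, has_ubound [set x i 0 | x in below g]).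

Lemma below_v g : 0 <= g -> below g v.
Proof. by move=> g0; split; rewrite ?gap_v. Qed.

Lemma below_has_sup g i : 0 <= g -> has_sup [set x i 0 | x in below g].
Proof. by move=> g0; split => //; exists (v i 0); exists v => //; exact: below_v. Qed.

Lemma below_le g g' x : g <= g' -> below g x -> below g' x.
Proof. by move=> gg' [Px gx]; split => //; exact: le_trans gg'. Qed.

Lemma height_ub g i x : below g x -> x i 0 <= height i g.
Proof. by move=> gx; apply: ub_le_sup; [exact: below_ubound|exists x]. Qed.

Lemma height_le (g M : R) i : 0 <= g -> (forall x, below g x -> x i 0 <= M) -> height i g <= M.
Proof.
move=> g0 H; apply: ge_sup; first by have [] := below_has_sup i g0.
by move=> _ [x gx <-]; exact: H.
Qed.

Lemma height_ge0 g i : 0 <= g -> 0 <= height i g.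
Proof.
move=> g0; apply: le_trans (height_ub i (below_v g0)).
by case: Pv.
Qed.

Lemma height_mono s t i : 0 <= s -> s <= t -> height i s <= height i t.
Proof.
by move=> s0 st; apply: height_le => // x sx; apply/height_ub/(below_le st).
Qed.

Lemma polyhedron_convex x y (l : R) : 0 <= l <= 1 -> P x -> P y ->
  P ((1 - l) *: x + l *: y).
Proof.
move=> /andP[l0 l1] [Ax x0] [Ay y0]; split.
  by rewrite mulmxDr -!scalemxAr Ax Ay -scalerDl subrK scale1r.
by move=> i; rewrite !mxE addr_ge0 // mulr_ge0 // subr_ge0.
Qed.

(** Contracting a point of gap at most [t] towards [v] by the factor [s / t] brings its gap below
    [s] and keeps that share of each coordinate. Thus [height i g / g] is nonincreasing in [g]. *)
Lemma height_star s t i : 0 < s -> s <= t -> s * height i t <= t * height i s.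
Proof.
move=> s0 st; have t0 := lt_le_trans s0 st.
rewrite mulrC -ler_pdivlMr //; apply: height_le; first exact: ltW.
move=> x [Px tx]; rewrite (_ : _ / s = (s / t)^-1 * height i s); last first.
  by rewrite invf_div mulrAC.
rewrite ler_pdivlMl ?divr_gt0 //.
have l01 : 0 <= s / t <= 1 by rewrite divr_ge0 ?(ltW s0) ?(ltW t0) //= ler_pdivrMr // mul1r.
have H : below s ((1 - s / t) *: v + (s / t) *: x).
  split; first exact: polyhedron_convex.
  by rewrite innerD !innerZ gap_v mulr0 add0r mulrAC ler_pdivrMr // ler_pM2l.
apply: le_trans (height_ub i H); rewrite !mxE lerDr.
by rewrite mulr_ge0 ?subr_ge0; case/andP: l01; case: Pv.
Qed.

Lemma gap_coord g x i : below g x -> c i 0 * x i 0 <= g.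
Proof.
move=> [[_ x0]]; apply: le_trans; rewrite /inner (bigD1 i) //= lerDl.
by apply: sumr_ge0 => j _; rewrite mulr_ge0.
Qed.

Lemma cost_height g i : 0 <= g -> c i 0 * height i g <= g.
Proof.
move=> g0; have [c0|c0] := eqVneq (c i 0) 0; first by rewrite c0 mul0r.
have cp : 0 < c i 0 by rewrite lt_neqAle eq_sym c0 c_ge0.
by rewrite -ler_pdivlMl //; apply: height_le => // x gx; rewrite ler_pdivlMl // gap_coord.
Qed.

Lemma gap_ge0 x : P x -> 0 <= inner c x.
Proof. by move=> [_ x0]; apply: sumr_ge0 => i _; rewrite mulr_ge0. Qed.

(** The average of [n] points, the [i]-th having at least half the height in coordinate [i]; aiming
    at half avoids attaining the supremum. *)
Lemma below_center g : (0 < n)%N -> 0 <= g ->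
  exists2 y, below g y & forall i, height i g / (2 * n%:R) <= y i 0.
Proof.
move=> n0 g0.
have n0' : 0 < n%:R :> R by rewrite ltr0n.
have /choice[f fH] : forall i, exists z, below g z /\ height i g / 2 <= z i 0.
  move=> i; have [h0|h0] := eqVneq (height i g) 0.
    by exists v; split; [exact: below_v|rewrite h0 mul0r; case: Pv].
  have : height i g / 2 < height i g.
    by have := height_ge0 i g0; move: h0; rewrite neq_lt; lra.
  by move=> /(sup_gt (proj1 (below_has_sup i g0)))[_ [x gx <-]] /ltW; exists x.
have fx i j : 0 <= f i j 0 by have [[[_ +] _] _] := fH i; apply.
exists (n%:R^-1 *: \sum_i f i).
  split; first split.
  - rewrite -scalemxAr mulmx_sumr (eq_bigr (fun=> b)); last first.
      by move=> i _; have [[[]]] := fH i.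
    by rewrite sumr_const card_ord -(scaler_nat _ b) scalerA mulVf ?scale1r ?gt_eqF.
  - move=> i; rewrite mxE mulr_ge0 ?invr_ge0 ?ler0n // summxE; exact: sumr_ge0.
  - have -> : \sum_i f i = \sum_(h <- [seq f i | i <- index_enum 'I_n]) h.
      by rewrite big_map.
    rewrite innerZ inner_sum big_map mulrC ler_pdivrMr // mulr_natr -[n in X in _ <= X]card_ord -sumr_const.
    by apply: ler_sum => i _; have [[]] := fH i.
move=> i; rewrite mxE summxE invfM mulrA [X in X <= _]mulrC ler_pM2l ?invr_gt0 //.
rewrite (bigD1 i) //=; apply: le_trans (proj2 (fH i)) _; rewrite lerDl.
exact: sumr_ge0.
Qed.

(** Some circuit of a conformal decomposition of [v - x] gains a fraction [1 / n] of the gap, and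
    the maximal step goes at least that far. *)
Lemma gap_step x : P x -> 0 < inner c x ->
  exists2 y, circuit_step A b x y & inner c y <= (1 - n%:R^-1) * inner c x.
Proof.
move=> Px gx.
have [Ax x0] := Px; have [Av v0] := Pv.
have [h [hE hd hc]] : exists h, [/\ elementary A h, conformal h (v - x) &
    inner c h <= inner c (v - x) / n%:R].
  apply: conformal_improvement; first by rewrite mulmxBr Av Ax subrr.
  by rewrite innerB gap_v sub0r oppr_lt0.
have n0 : (0 < n)%N.
  by rewrite lt0n; apply/eqP => n0; move: gx; rewrite /inner big1 ?ltxx // => i; have := ltn_ord i; rewrite [X in (_ < X)%N]n0.
have n0' : 0 < n%:R :> R by rewrite ltr0n.
move: hc; rewrite innerB gap_v sub0r => hc.
have hn : inner c h < 0.
  by apply: le_lt_trans hc _; rewrite mulNr oppr_lt0 divr_gt0.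
have Pxh : P (x + h).
  split; first by rewrite mulmxDr Ax; case: hE => -> _ _; rewrite addr0.
  move=> i; rewrite !mxE; have := hd i; have := x0 i; have := v0 i; rewrite !mxE.
  by move=> ? ? [|] /andP[]; lra.
(* As [c] is nonnegative, a circuit that lowers the cost has a negative entry. *)
have hi : exists i, h i 0 < 0.
  apply: contrapT => H; move: hn; rewrite ltNge => /negP; apply.
  apply: sumr_ge0 => i _; rewrite mulr_ge0 // leNgt; apply/negP => ?.
  by apply: H; exists i.
have [a [a1 s _]] := maximal_step Px Pxh hE hi.
exists (x + a *: h) => //; rewrite innerD innerZ mulrBl mul1r lerD2l.
apply: (@le_trans _ _ (inner c h)); first by rewrite -subr_ge0; nra.
by move: hc; rewrite mulNr mulrC.
Qed.

Lemma gap_steps T g x : (0 < n)%N -> 0 <= g -> below g x ->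
  exists2 y, reach A b T x y & below ((1 - n%:R^-1) ^+ T * g) y.
Proof.
move=> n0 g0; elim: T x => [|T IH] x gx; first by exists x; [left|rewrite expr0 mul1r].
have n1 : 0 <= 1 - n%:R^-1 :> R by rewrite subr_ge0 invf_le1 ?ltr0n // ler1n.
have [y xy [Py yg]] := IH x gx.
have [gy|gy] := leP (inner c y) 0.
  exists y; first exact: reach_leq xy.
  by split => //; apply: le_trans gy _; rewrite mulr_ge0 // exprn_ge0.
have [z yz zg] := gap_step Py gy.
exists z; first by rewrite -addn1; apply: reach_trans xy (reach_step yz).
have Pz : P z by case: yz => [h [a []]].
by split => //; apply: le_trans zg _; rewrite exprS -mulrA ler_wpM2l.
Qed.

Implicit Types (D N : {set 'I_n}) (d e : 'rV[R]_n) (g s t : R).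

(** * Free spaces *)

(* Division by a height 0 gives 0, so that coordinates which vanish on the whole
   polyhedron are ignored; [free_space] requires them to be 0 separately. *)
Definition mass (D : {set 'I_n}) (g : R) (d : 'rV[R]_n) : R :=
  \sum_(i in D) (d 0 i / height i g) ^+ 2.

Definition free_space (N : {set 'I_n}) (g : R) (V : 'M[R]_n) :=
  forall d : 'rV[R]_n, (d <= V)%MS ->
    [/\ A *m d^T = 0, forall i, height i g = 0 -> d 0 i = 0 &
      mass (~: N) g d <= mass N g d].

Lemma mass_ge0 D g d : 0 <= mass D g d.
Proof. by apply: sumr_ge0 => i _; rewrite sqr_ge0. Qed.

Lemma mass_coord D g d i (K : R) : i \in D -> (height i g = 0 -> d 0 i = 0) ->
  0 <= g -> 0 <= K -> mass D g d <= K ^+ 2 -> `|d 0 i| <= K * height i g.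
Proof.
move=> iD h0 g0 K0 dK; have [h|h] := eqVneq (height i g) 0.
  by rewrite h0 // normr0 h mulr0.
have hp : 0 < height i g by rewrite lt_neqAle eq_sym h height_ge0.
rewrite -ler_pdivrMr // -[height i g]ger0_norm; last exact: ltW.
rewrite -normf_div -(@ler_pXn2r _ 2) ?nnegrE // real_normK ?num_real //.
apply: le_trans dK; rewrite /mass (bigD1 i) //= lerDl.
by apply: sumr_ge0 => j _; rewrite sqr_ge0.
Qed.

Lemma mass_le D g d (K : R) : (forall i, i \in D -> (d 0 i / height i g) ^+ 2 <= K) ->
  0 <= K -> mass D g d <= n%:R * K.
Proof.
move=> H K0; apply: (@le_trans _ _ (\sum_(i in D) K)); first exact: ler_sum.
rewrite sumr_const -(mulr_natl K) ler_wpM2r // ler_nat.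
by apply: leq_trans (max_card _) _; rewrite card_ord.
Qed.

Lemma massD D g d e : mass D g (d + e) <= 2 * mass D g d + 2 * mass D g e.
Proof.
rewrite /mass !mulr_sumr -big_split /=; apply: ler_sum => i _.
by rewrite mxE mulrDl; set p := d 0 i / _; set q := e 0 i / _; have := sqr_ge0 (p - q); nra.
Qed.

Lemma massZ D g (a : R) d : mass D g (a *: d) = a ^+ 2 * mass D g d.
Proof.
by rewrite /mass mulr_sumr; apply: eq_bigr => i _; rewrite mxE -mulrA exprMn.
Qed.

(* [s] and [t] bound a range on which the heights in [N] are proportional to
   the gap and the other heights are constant, both up to a factor 4. *)
Definition polarized (N : {set 'I_n}) (s t : R) :=
  (forall i, i \in N -> t * height i s <= 4 * (s * height i t)) /\
  (forall i, i \notin N -> height i t <= 4 * height i s).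

(** By [height_mono] and [height_star], vanishing at one positive gap means vanishing at all; this
    makes the zero condition of [free_space] independent of the gap. *)
Lemma height_eq0 s t i : 0 < s -> 0 < t -> height i s = 0 -> height i t = 0.
Proof.
move=> s0 t0 hs; have := height_ge0 i (ltW t0).
have [st|/ltW ts] := leP s t.
  have := height_star i s0 st; rewrite hs mulr0 pmulr_rle0 // => ? ?.
  exact/le_anti/andP.
by have := height_mono i (ltW t0) ts; rewrite hs => ? ?; exact/le_anti/andP.
Qed.

Lemma polarized_height N s t g i : 0 < s -> s <= g -> g <= t -> polarized N s t ->
  i \in N -> height i g <= 4 * (g / t) * height i t.
Proof.
move=> s0 sg gt [HN _] iN; have g0 := lt_le_trans s0 sg; have t0 := lt_le_trans g0 gt.
have H1 := height_star i s0 sg; have H2 := HN i iN.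
rewrite (_ : 4 * _ * _ = 4 * g * height i t / t); last by field; rewrite gt_eqF.
rewrite ler_pdivlMr // -(ler_pM2l s0).
have : s * height i g * t <= g * height i s * t by rewrite ler_pM2r.
have : g * (t * height i s) <= g * (4 * (s * height i t)) by rewrite ler_pM2l.
by nra.
Qed.

Lemma mass_flat D s t d : 0 < s -> s <= t -> (forall i, i \in D -> height i t <= 4 * height i s) ->
  mass D s d <= 16 * mass D t d.
Proof.
move=> s0 st HB; have t0 := lt_le_trans s0 st.
rewrite /mass mulr_sumr; apply: ler_sum => i iD.
have [h|h] := eqVneq (height i s) 0.
  by rewrite h invr0 mulr0 expr0n /= mulr_ge0 ?sqr_ge0.
have hs : 0 < height i s by rewrite lt_neqAle eq_sym h height_ge0 // ltW.
have ht := lt_le_trans hs (height_mono i (ltW s0) st).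
rewrite (_ : d 0 i / height i s = d 0 i / height i t * (height i t / height i s)).
  have : 0 <= height i t / height i s by rewrite divr_ge0 ?ltW.
  have : height i t / height i s <= 4 by rewrite ler_pdivrMr // HB.
  set q := _ / height i s => q4 q0; set r := d 0 i / _.
  rewrite (_ : (r * q) ^+ 2 = q ^+ 2 * r ^+ 2); last by ring.
  by rewrite ler_wpM2r ?sqr_ge0 //; nra.
by field; rewrite !gt_eqF.
Qed.

(** Compare [mass_flat]: from [t] down to [s], proportional coordinates gain a factor
    [(t / (4 * s)) ^+ 2] in mass and flat ones at most 16. So a free space stays free when the types
    persist and [t / s] is large enough. *)
Lemma mass_steep D s t d : 0 < s -> s <= t ->
  (forall i, i \in D -> t * height i s <= 4 * (s * height i t)) ->
  (t / (4 * s)) ^+ 2 * mass D t d <= mass D s d.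
Proof.
move=> s0 st HN; have t0 := lt_le_trans s0 st.
rewrite /mass mulr_sumr; apply: ler_sum => i iD.
have [h|h] := eqVneq (height i t) 0.
  by rewrite h invr0 mulr0 expr0n /= mulr0 sqr_ge0.
have ht : 0 < height i t by rewrite lt_neqAle eq_sym h height_ge0 // ltW.
have hs : 0 < height i s.
  rewrite lt_neqAle height_ge0 ?ltW // andbT eq_sym.
  by apply: contra h => /eqP /(height_eq0 s0 t0) ->.
rewrite (_ : d 0 i / height i s = d 0 i / height i t * (height i t / height i s)).
  have : t / (4 * s) <= height i t / height i s.
    rewrite ler_pdivlMr // mulrAC ler_pdivrMr ?mulr_gt0 ?ltr0n //.
    by have := HN i iD; nra.
  have : 0 <= t / (4 * s) by rewrite divr_ge0 ?mulr_ge0 ?ler0n ?ltW.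
  set q := _ / height i s; set p := t / _ => p0 pq; set r := d 0 i / _.
  rewrite (_ : (r * q) ^+ 2 = q ^+ 2 * r ^+ 2); last by ring.
  by rewrite ler_wpM2r ?sqr_ge0 //; nra.
by field; rewrite !gt_eqF.
Qed.

Lemma sqr_ratio_le (p q K : R) : 0 <= q -> 0 <= K -> `|p| <= K * q -> (p / q) ^+ 2 <= K ^+ 2.
Proof.
move=> q0 K0 pq; have [->|qn] := eqVneq q 0; first by rewrite invr0 mulr0 expr0n /= sqr_ge0.
have qp : 0 < q by rewrite lt_neqAle eq_sym qn.
rewrite -[_ ^+ 2]real_normK ?num_real // ler_pXn2r ?nnegrE // normf_div (ger0_norm q0).
by rewrite ler_pdivrMr.
Qed.

Lemma mass_wdot N t d : mass N t d =
  wdot (fun i => if i \in N then (height i t)^-1 ^+ 2 else 0) d d.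
Proof.
rewrite /mass /wdot big_mkcond; apply: eq_bigr => i _.
by case: ifP => _; rewrite ?mul0r // exprMn; ring.
Qed.

(* Writing [x - y = u + e] with [u] in [V] and [e] orthogonal to [V] on [N],
   the space [V + <e>] is not free at gap [s], which forces [e] to be small. *)
Lemma free_space_split N s t V (a : 'rV[R]_n) (K L : R) : 0 < s -> 32 * s <= t -> polarized N s t ->
  free_space N t V -> (forall V', free_space N s V' -> (\rank V' <= \rank V)%N) ->
  A *m a^T = 0 -> (forall i, height i t = 0 -> a 0 i = 0) ->
  mass N t a <= K -> mass (~: N) t a <= L -> K <= L ->
  exists u, [/\ (u <= V)%MS, mass N t u <= K, mass (~: N) t u <= K &
    mass N t (a - u) <= 2048 * L * (s / t) ^+ 2].
Proof.
move=> s0 st pol fV Vmax Aa a0 aK aL KL.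
have t0 : 0 < t by lra.
have st' : s <= t by lra.
pose om i := if i \in N then (height i t)^-1 ^+ 2 else 0.
have om0 i : 0 <= om i by rewrite /om; case: ifP => // _; rewrite sqr_ge0.
have massE d : mass N t d = wdot om d d by exact: mass_wdot.
(* The weights vanish outside [N], but on a free space the mass in [N] controls the rest, so the
   form is definite there. *)
have Vpos d : (d <= V)%MS -> wdot om d d = 0 -> d = 0.
  move=> /fV[_ d0 dm]; rewrite -massE => dN.
  have dB : mass (~: N) t d <= 0 ^+ 2 by apply: le_trans dm _; rewrite dN sqr_ge0.
  apply/rowP => i; rewrite mxE; apply/eqP; rewrite -normr_le0.
  suff : `|d 0 i| <= 0 * height i t by rewrite mul0r.
  have [iN|iN] := boolP (i \in N).
    by apply: (mass_coord iN) => //; [exact: d0|exact: ltW|rewrite dN sqr_ge0].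
  by apply: (@mass_coord (~: N)) => //; [rewrite inE|exact: d0|exact: ltW].
have [u uV uort] := weighted_projection a om0 Vpos.
set e := a - u in uort *.
have wdotD d d' : wdot om (d + d') (d + d') = wdot om d d + wdot om d' d' + 2 * wdot om d' d.
  rewrite /wdot mulr_sumr -!big_split /=; apply: eq_bigr => i _; rewrite !mxE; ring.
have pyth d (k : R) : (d <= V)%MS -> mass N t (d + k *: e) = mass N t d + k ^+ 2 * mass N t e.
  move=> dV; rewrite -massZ !massE wdotD (_ : wdot om (k *: e) d = k * wdot om e d).
    by rewrite uort // mulr0 mulr0 addr0.
  by rewrite /wdot mulr_sumr; apply: eq_bigr => i _; rewrite mxE; ring.
have aE : a = u + 1 *: e by rewrite scale1r addrC subrK.
have [Au u0 uBN] := fV u uV.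
have e0 : 0 <= mass N t e by exact: mass_ge0.
have uK : mass N t u <= K.
  by apply: le_trans aK; rewrite aE pyth // expr1n mul1r lerDl.
exists u; split => //; first exact: le_trans uBN uK.
rewrite leNgt; apply/negP => elarge.
have L0 : 0 <= L by apply: le_trans KL; apply: le_trans aK; exact: mass_ge0.
have eB : mass (~: N) t e <= 4 * L.
  rewrite /e; apply: le_trans (massD _ _ _ _) _.
  rewrite -scaleN1r massZ sqrrN expr1n mul1r.
  by have := le_trans uBN uK; lra.
have Ae : A *m e^T = 0 by rewrite /e linearB /= mulmxBr Aa Au subrr.
have st0 : 0 <= 2048 * L * (s / t) ^+ 2.
  by apply: mulr_ge0 (sqr_ge0 _); apply: mulr_ge0 L0; exact: ler0n.
have eV : ~~ (e <= V)%MS.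
  apply/negP => eV; move: elarge; rewrite massE uort // ltNge => /negP; apply.
  exact: st0.
have /Vmax : free_space N s (V + e)%MS.
  move=> d' /sub_addsmxP[[z1 z2] /= ->]; rewrite [z2]mx11_scalar mul_scalar_mx.
  move: (z1 *m V) (z2 0 0) (submxMl z1 V) => d k dV.
  have [Ad d0 dBN] := fV d dV; split.
  - by rewrite linearD linearZ /= mulmxDr -scalemxAr Ad Ae scaler0 addr0.
  - by move=> i /(height_eq0 s0 t0) it; rewrite !mxE d0 // a0 // u0 // subrr mulr0 addr0.
  have sB : mass (~: N) s (d + k *: e) <= 16 * mass (~: N) t (d + k *: e).
    by apply: mass_flat => // i; rewrite inE; exact: (proj2 pol).
  have sN := mass_steep (d + k *: e) s0 st' (proj1 pol).
  apply: le_trans sB _; apply: le_trans sN; rewrite pyth //.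
  have := massD (~: N) t d (k *: e); rewrite massZ => H.
  have r1 : 32 <= (t / (4 * s)) ^+ 2.
    have : 8 <= t / (4 * s) by rewrite ler_pdivlMr ?mulr_gt0 ?ltr0n //; lra.
    set r := t / _; nra.
  (* The constant 2048 is [16 * 128]: at gap [s] the mass of [e] in [N] then exceeds
     [16 * 2 * (4 * L)], which pays for the part of [k *: e] outside [N]. *)
  have r2 : 128 * L <= (t / (4 * s)) ^+ 2 * mass N t e.
    apply: (@le_trans _ _ ((t / (4 * s)) ^+ 2 * (2048 * L * (s / t) ^+ 2))).
      rewrite (_ : _ * (2048 * L * _) = 128 * L) //.
      by field; rewrite !gt_eqF.
    by rewrite ler_wpM2l ?sqr_ge0 // ltW.
  rewrite mulrDr [_ * (k ^+ 2 * _)]mulrCA.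
  have k2 := sqr_ge0 k.
  have : k ^+ 2 * (128 * L) <= k ^+ 2 * ((t / (4 * s)) ^+ 2 * mass N t e) by rewrite ler_wpM2l.
  have : 32 * mass N t d <= (t / (4 * s)) ^+ 2 * mass N t d by rewrite ler_wpM2r // mass_ge0.
  have : k ^+ 2 * mass (~: N) t e <= k ^+ 2 * (4 * L) by rewrite ler_wpM2l.
  by move: H dBN; lra.
rewrite leqNgt => /negP; apply; apply: rank_ltmx; rewrite /ltmx addsmxSl /=.
by apply: contra eV => /(submx_trans (addsmxSr _ _)).
Qed.

Local Notation nu := (n%:R : R).

(** Take [w = (1 - lam) (x - u) + lam y], where [y] is a central point of gap [l] and [u] in [V]
    nearly equals [x - y] on [N]. There [w] is close to [y], hence of order [l / t]; outside [N],
    [u] is small since [V] is free, and [lam y] compensates for it. *)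
Lemma near_target N s t l x V : (0 < n)%N -> 0 < s -> polarized N s t ->
  free_space N t V -> (forall V', free_space N s V' -> (\rank V' <= \rank V)%N) ->
  below (t / (128 * nu ^+ 3)) x -> 184 * nu ^+ 2 * s <= l -> l <= t / (128 * nu ^+ 3) ->
  exists w, [/\ P w,
    forall j, j \notin N -> (1 - (4 * nu)^-1) * x j 0 <= w j 0 <= 3 * height j t &
    forall i, i \in N ->
      l / (4 * nu * t) * height i t <= w i 0 <= 5 * (l / t) * height i t].
Proof.
move=> n0 s0 pol fV Vmax Tx sl lT.
have nu1 : 1 <= nu by rewrite ler1n.
have nu0 : 0 < nu by rewrite ltr0n.
have nu2 : 1 <= nu ^+ 2 by rewrite exprn_ege1.
have nu3 : 1 <= nu ^+ 3 by rewrite exprn_ege1.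
have sl' : s <= l by apply: le_trans sl; nra.
have l0 := lt_le_trans s0 sl'.
set T := t / _ in Tx lT.
have T0 := lt_le_trans l0 lT.
have tT : t = T * (128 * nu ^+ 3) by rewrite /T divfK // gt_eqF // mulr_gt0 // ?ltr0n // exprn_gt0.
have t0 : 0 < t by rewrite tT mulr_gt0 // mulr_gt0 ?ltr0n // exprn_gt0.
have Tt : 128 * T <= t by rewrite tT; nra.
have sT : s <= T by exact: le_trans lT.
have [s0' t0' l0' nu0'] : [/\ 0 <= s, 0 <= t, 0 <= l & 0 <= nu] by rewrite !ltW.
have [y ly yc] := below_center n0 (ltW l0).
have [Px gx] := Tx; have [Py gy] := ly.
have [Ax x0] := Px; have [Ay y0] := Py.
have tx : below t x by apply: below_le Tx; lra.
have ty : below t y by apply: below_le ly; lra.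
have ax : forall i, 0 <= x i 0 <= height i t by move=> i; rewrite x0 height_ub.
have ay : forall i, 0 <= y i 0 <= height i t by move=> i; rewrite y0 height_ub.
have rho0 i : 0 <= height i t by apply: height_ge0; exact: ltW.
pose a : 'rV[R]_n := (x - y)^T.
have aE i : a 0 i = x i 0 - y i 0 by rewrite !mxE.
(* By [polarized_height], [q] bounds [x - y] on [N] relatively to the heights at [t]. *)
pose q : R := 4 * (T / t).
have q0 : 0 <= q by rewrite mulr_ge0 // divr_ge0 // ltW.
have qE : q = (32 * nu ^+ 3)^-1.
  by rewrite /q tT; field; rewrite !gt_eqF.
have [u [uV uN uB eN]] : exists u, [/\ (u <= V)%MS, mass N t u <= nu * q ^+ 2,
    mass (~: N) t u <= nu * q ^+ 2 & mass N t (a - u) <= 2048 * nu * (s / t) ^+ 2].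
  apply: free_space_split fV Vmax _ _ _ _ _ => //.
  - by lra.
  - by rewrite /a trmxK mulmxBr Ax Ay subrr.
  - by move=> i hi; rewrite aE; have := ax i; have := ay i; rewrite hi; lra.
  - apply: mass_le; last exact: sqr_ge0.
    move=> i iN; apply: sqr_ratio_le => //; rewrite aE ler_norml.
    have := polarized_height s0 sT (le_trans _ Tt) pol iN.
    have Ti := height_ub i Tx.
    have Ti' := height_ub i (below_le lT ly).
    have := x0 i; have := y0 i; rewrite -/q => ? ? H.
    by have {}H := H ltac:(lra); apply/andP; split; lra.
  - rewrite -[X in _ <= X]mulr1; apply: mass_le => // i _.
    rewrite -(expr1n _ 2); apply: sqr_ratio_le => //; rewrite aE mul1r ler_norml.
    by have := ax i; have := ay i => /andP[? ?] /andP[? ?]; apply/andP; split; lra.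
  - rewrite -[X in _ <= X]mulr1 ler_wpM2l // qE expr_le1 // ?invr_ge0 ?mulr_ge0 ?exprn_ge0 //.
    by rewrite invf_le1 ?mulr_gt0 ?exprn_gt0 //; lra.
have [Au u0 _] := fV u uV.
have a0 i : height i t = 0 -> a 0 i = 0.
  by move=> hi; rewrite aE; have := ax i; have := ay i; rewrite hi; lra.
pose del : R := (32 * nu ^+ 2)^-1.
have del0 : 0 <= del by rewrite invr_ge0 mulr_ge0 // exprn_ge0.
have uB' j : j \notin N -> `|u 0 j| <= del * height j t.
  move=> jN; apply: (@mass_coord (~: N)) => //; [by rewrite inE|exact: u0|].
  apply: le_trans uB _; rewrite qE (_ : _ * _ = del ^+ 2 * nu^-1); last first.
    by rewrite /del; field; rewrite gt_eqF.
  by rewrite -[X in _ <= X]mulr1 ler_wpM2l ?sqr_ge0 // invf_le1.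
(* Here [46 ^ 2 >= 2048], and [184 * nu ^+ 2 * s <= l] says that [eps <= l / (4 * nu * t)]. *)
pose eps : R := 46 * nu * (s / t).
have eps0 : 0 <= eps by rewrite !mulr_ge0 ?invr_ge0 //.
have eN' i : i \in N -> `|(a - u) 0 i| <= eps * height i t.
  move=> iN; apply: (mass_coord iN) => //.
    by move=> hi; rewrite !mxE; have := a0 i hi; rewrite aE u0 // => ->; rewrite subrr.
  apply: le_trans eN _; rewrite (_ : eps ^+ 2 = 2116 * nu ^+ 2 * (s / t) ^+ 2).
    by rewrite ler_wpM2r ?sqr_ge0 //; nra.
  by rewrite /eps; ring.
(* Outside [N], [y j 0] is at least [height j t / (8 * nu)]; times [lam] this is exactly
   [del * height j t], the bound on [u]. *)
pose lam : R := (4 * nu)^-1.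
have lamnu : lam * nu = 4^-1 by rewrite /lam; field; rewrite gt_eqF.
have lam0 : 0 <= lam by rewrite invr_ge0 mulr_ge0 //.
have lam1 : lam <= 1 by nra.
pose w := (1 - lam) *: (x - u^T) + lam *: y.
have wB j : j \notin N -> (1 - lam) * x j 0 <= w j 0 <= 3 * height j t.
  move=> jN; rewrite !mxE.
  have := uB' j jN; rewrite ler_norml => /andP[u1 u2].
  have yl : del * height j t <= lam * y j 0.
    have jt := proj2 pol j jN; have sj := height_mono j (ltW s0) sl'.
    have : height j t / (8 * nu) <= y j 0.
      apply: le_trans (yc j); rewrite ler_pdivlMr ?mulr_gt0 // mulrAC ler_pdivrMr ?mulr_gt0 //.
      by nra.
    move=> /(ler_wpM2l lam0); apply: le_trans.
    by rewrite (_ : lam * _ = del * height j t) // /lam /del; field; rewrite gt_eqF.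
  have del1 : del <= 1 by rewrite /del invf_le1 ?mulr_gt0 ?exprn_gt0 //; lra.
  have /andP[? ?] := ax j; have /andP[? ?] := ay j; have := rho0 j.
  by move=> ?; apply/andP; split; nra.
have wN i : i \in N ->
    l / (4 * nu * t) * height i t <= w i 0 <= 5 * (l / t) * height i t.
  move=> iN.
  have -> : w i 0 = y i 0 + (1 - lam) * (a - u) 0 i by rewrite !mxE; ring.
  have := eN' i iN; rewrite ler_norml; set e := (a - u) 0 i => /andP[e1 e2].
  set et := l / (4 * nu * t) * height i t.
  have eps_et : eps * height i t <= et.
    rewrite ler_wpM2r // /eps ler_pdivlMr ?mulr_gt0 //.
    by rewrite (_ : 46 * nu * (s / t) * (4 * nu * t) = 184 * nu ^+ 2 * s) //; field; rewrite gt_eqF.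
  have y_et : 2 * et <= y i 0.
    apply: le_trans (yc i); rewrite (_ : 2 * et = l / t * height i t / (2 * nu)).
      rewrite ler_pM2r ?invr_gt0 ?mulr_gt0 // mulrAC ler_pdivrMr // [X in _ <= X]mulrC.
      by apply: height_star => //; lra.
    by rewrite /et; field; rewrite !gt_eqF.
  have et0 : 0 <= et by rewrite !mulr_ge0 ?invr_ge0 ?mulr_ge0 //.
  have et_l : et <= l / t * height i t.
    rewrite ler_wpM2r // ler_wpM2l // lef_pV2 ?posrE ?mulr_gt0 //.
    by rewrite ler_peMl //; lra.
  have y_l : y i 0 <= 4 * (l / t) * height i t.
    apply: le_trans (height_ub i ly) (polarized_height s0 sl' _ pol iN); lra.
  by apply/andP; split; nra.
exists w; split => //.
split; first by rewrite /w mulmxDr -!scalemxAr mulmxBr Au Ax Ay subr0 -scalerDl subrK scale1r.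
move=> i; have [iN|iN] := boolP (i \in N).
  have /andP[+ _] := wN i iN; apply: le_trans.
  by rewrite !mulr_ge0 ?invr_ge0 ?mulr_ge0 //.
have /andP[+ _] := wB i iN; apply: le_trans.
by rewrite mulr_ge0 // subr_ge0.
Qed.

(** * Traversing a polarized range *)

(** The threshold is the lower bound on [w] in [near_target]: a light coordinate of [N] does not
    decrease along a circuit conformal to [w - x]. *)
Definition heavy N t (l : R) x : {set 'I_n} :=
  [set i in N | l / (4 * nu * t) * height i t < x i 0]%SET.

(* As the circuit decreases a coordinate by at least [1 / (2 n)] of its value,
   the step length is at most [2 n]; this bounds the overshoot everywhere, and
   it only lets a heavy coordinate block the step. *)
Lemma fast_step N s t l G x V : (0 < n)%N -> 0 < s -> polarized N s t ->
  free_space N t V -> (forall V', free_space N s V' -> (\rank V' <= \rank V)%N) ->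
  below G x -> G <= t / (128 * nu ^+ 3) ->
  184 * nu ^+ 2 * s <= l -> l <= t / (128 * nu ^+ 3) ->
  (exists2 i, i \in N & 10 * (l / t) * height i t < x i 0) ->
  exists x', [/\ circuit_step A b x x', below (G + 24 * nu ^+ 2 * l) x' &
    (#|heavy N t (40 * nu ^+ 2 * l) x'| < #|heavy N t l x|)%N].
Proof.
move=> n0 s0 pol fV Vmax Gx GT sl lT [i iN xi].
have nu1 : 1 <= nu by rewrite ler1n.
have nu0 : 0 < nu by rewrite ltr0n.
have nu2 : 1 <= nu ^+ 2 by rewrite exprn_ege1.
have sl' : s <= l by apply: le_trans sl; nra.
have l0 := lt_le_trans s0 sl'.
have t0 : 0 < t.
  by have := lt_le_trans l0 lT; rewrite pmulr_lgt0 // invr_gt0 mulr_gt0 ?exprn_gt0 ?ltr0n.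
have [w [[Aw w0] wB wN]] := near_target n0 s0 pol fV Vmax (below_le GT Gx) sl lT.
have [[Ax x0] gx] := Gx.
have rho0 k : 0 <= height k t by apply: height_ge0; exact: ltW.
have xi0 : 0 < x i 0 by apply: le_lt_trans xi; rewrite !mulr_ge0 ?invr_ge0 // ltW.
have wi : w i 0 <= x i 0 / 2 by have /andP[_] := wN i iN; move: xi; lra.
(* The circuit is chosen to improve coordinate [i] instead of the cost: it lowers it by at least
   [x i 0 / (2 * nu)], whence [a <= 2 * nu] below. *)
have [h [hE hd hi]] : exists h, [/\ elementary A h, conformal h (w - x) &
    inner (delta_mx i 0) h <= inner (delta_mx i 0) (w - x) / nu].
  apply: conformal_improvement; first by rewrite mulmxBr Aw Ax subrr.
  by rewrite inner_delta !mxE; lra.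
move: hi; rewrite !inner_delta !mxE => hi.
have {}hi : h i 0 * (2 * nu) <= - x i 0.
  by move: hi; rewrite ler_pdivlMr //; lra.
have hin : h i 0 < 0 by rewrite -(pmulr_llt0 (x := 2 * nu)) ?mulr_gt0 ?ltr0n //; lra.
have Pxh : P (x + h).
  split; first by rewrite mulmxDr Ax; case: hE => -> _ _; rewrite addr0.
  move=> k; rewrite !mxE; have := hd k; have := x0 k; have := w0 k; rewrite !mxE.
  by move=> ? ? [|] /andP[]; lra.
have [a [a1 st [j hj aj]]] := maximal_step (proj1 Gx) Pxh hE (ex_intro _ i hin).
have Px' : P (x + a *: h) by case: st => [? [? []]].
have a2 : a <= 2 * nu.
  have := proj2 Px' i; rewrite !mxE => H.
  by rewrite -(ler_pM2r xi0); nra.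
have xw k : x k 0 + a * h k 0 <= x k 0 + 2 * nu * w k 0.
  rewrite lerD2l; have := hd k; have := w0 k; have := x0 k; rewrite !mxE.
  by move=> xk wk [/andP[h1 h2]|/andP[h1 h2]];
     [apply: (@le_trans _ _ (a * w k 0)); [rewrite ler_wpM2l //|rewrite ler_wpM2r //]
     |apply: (@le_trans _ _ 0); [rewrite mulr_ge0_le0|rewrite !mulr_ge0]] => //; lra.
have jheavy : j \in heavy N t l x.
  have dj : w j 0 < x j 0.
    by have := hd j; rewrite !mxE => -[|] /andP[]; lra.
  rewrite inE; have [jN|jN] /= := boolP (j \in N).
    by have /andP[+ _] := wN j jN; move/le_lt_trans; apply.
  (* Outside [N] the whole step lowers [x j 0] by at most [2 * nu * (x j 0 / (4 * nu))], half of it,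
     so it cannot block. *)
  have /andP[+ _] := wB j jN => wj.
  have hwj : w j 0 - x j 0 <= h j 0.
    by have := hd j; rewrite !mxE => -[|] /andP[]; lra.
  have lamnu : (4 * nu)^-1 * nu = 4^-1 by field; rewrite gt_eqF.
  have lam0 : 0 < (4 * nu)^-1 by rewrite invr_gt0 mulr_gt0 ?ltr0n.
  move: wj lamnu lam0; set lam := _^-1 => wj lamnu lam0.
  have hj' : - (lam * x j 0) <= h j 0 by lra.
  have xj : 0 < x j 0.
    by rewrite lt_neqAle x0 andbT eq_sym; apply/eqP => xj; move: hj'; rewrite xj; lra.
  have : a * - (lam * x j 0) <= a * h j 0 by rewrite ler_wpM2l //; lra.
  have : a * (lam * x j 0) <= 2 * nu * (lam * x j 0) by rewrite ler_wpM2r // mulr_ge0 // ltW.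
  have -> : 2 * nu * (lam * x j 0) = 2 * (lam * nu) * x j 0 by ring.
  by rewrite lamnu; move: aj xj; lra.
exists (x + a *: h); split => //.
  split => //; rewrite innerD; apply: lerD => //.
  rewrite innerZ /inner mulr_sumr.
  apply: (@le_trans _ _ (\sum_(k < n) (24 * nu * l))); last first.
    rewrite sumr_const card_ord -(mulr_natr (24 * nu * l)) le_eqVlt.
    by apply/orP; left; apply/eqP; ring.
  apply: ler_sum => k _.
  have -> : a * (c k 0 * h k 0) = c k 0 * (a * h k 0) by ring.
  have akw : a * h k 0 <= 2 * nu * w k 0 by have := xw k; lra.
  apply: le_trans (ler_wpM2l (c_ge0 k) akw) _.
  (* The cost of [w k 0] is at most [5 * l] in [N], and at most [3 * (4 * s)] outside by
     polarization. *)
  suff : c k 0 * w k 0 <= 12 * l by move=> ?; nra.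
  have [kN|kN] := boolP (k \in N).
    have /andP[_ +] := wN k kN => wk.
    apply: le_trans (ler_wpM2l (c_ge0 k) wk) _.
    have -> : c k 0 * (5 * (l / t) * height k t) = 5 * (l / t) * (c k 0 * height k t) by ring.
    have ct := cost_height k (ltW t0).
    apply: (@le_trans _ _ (5 * (l / t) * t)).
      by rewrite ler_wpM2l // !mulr_ge0 ?invr_ge0 // ltW.
    by rewrite mulrA divfK ?gt_eqF //; lra.
  have /andP[_ +] := wB k kN => wk.
  have := proj2 pol k kN; have := cost_height k (ltW s0); have := c_ge0 k.
  by nra.
(* Coordinate [j] is now 0, and a light coordinate [k] ends at most at [2 * nu * w k 0], which is
   light at the new level. *)
apply: proper_card; apply/properP; split; last first.
  exists j => //; rewrite inE !mxE aj negb_and -leNgt; apply/orP; right.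
  by rewrite !mulr_ge0 ?invr_ge0 ?mulr_ge0 ?exprn_ge0 // ltW.
apply/fintype.subsetP => k; rewrite !inE !mxE => /andP[kN kx]; rewrite kN /=.
rewrite ltNge; apply/negP => xk.
have /andP[wk1 wk2] := wN k kN.
have : x k 0 + a * h k 0 <= 2 * nu * w k 0.
  have hk : h k 0 <= w k 0 - x k 0.
    by have := hd k; rewrite !mxE => -[|] /andP[]; lra.
  have : a * h k 0 <= a * (w k 0 - x k 0) by rewrite ler_wpM2l //; lra.
  have : a * (w k 0 - x k 0) <= 2 * nu * (w k 0 - x k 0) by rewrite ler_wpM2r //; lra.
  by have := x0 k; nra.
have : 2 * nu * w k 0 <= 2 * nu * (5 * (l / t) * height k t) by rewrite ler_wpM2l // mulr_ge0 // ltW.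
rewrite (_ : 2 * nu * (5 * _ * _) = 40 * nu ^+ 2 * l / (4 * nu * t) * height k t); first by lra.
by field; rewrite !gt_eqF.
Qed.

(* The level [l] below which coordinates count as light grows by a factor
   [40 n ^ 2] at each of the at most [n] steps. *)
Lemma fast_walk_rec k N s t l M G x V : (0 < n)%N -> 0 < s -> polarized N s t ->
  free_space N t V -> (forall V', free_space N s V' -> (\rank V' <= \rank V)%N) ->
  below G x -> (#|heavy N t l x| <= k)%N ->
  184 * nu ^+ 2 * s <= l -> l * (40 * nu ^+ 2) ^+ k <= M ->
  M <= t / (128 * nu ^+ 3) -> G + k%:R * (24 * nu ^+ 2 * M) <= t / (128 * nu ^+ 3) ->
  exists x', [/\ reach A b k x x', below (t / (128 * nu ^+ 3)) x' &
    forall i, i \in N -> x' i 0 <= 10 * (M / t) * height i t].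
Proof.
move=> n0 s0 pol fV Vmax.
have nu1 : 1 <= nu by rewrite ler1n.
have nu2 : 1 <= nu ^+ 2 by rewrite exprn_ege1.
have nu3 : 0 < nu ^+ 3 by rewrite exprn_gt0 // ltr0n.
set T := t / _.
elim: k l G x => [|k IH] l G x Gx hk sl lM MT GM.
all: have l0 : 0 < l by apply: lt_le_trans sl; rewrite !mulr_gt0 ?ltr0n ?exprn_gt0.
all: have lM' : l <= M by apply: le_trans lM; rewrite ler_peMr ?(ltW l0) // exprn_ege1 //; lra.
all: have M0 := lt_le_trans l0 lM'.
all: have kM j : 0 <= j%:R * (24 * nu ^+ 2 * M)
  by rewrite !mulr_ge0 ?exprn_ge0 // ltW.
all: have GT : G <= T by apply: le_trans GM; rewrite lerDl.
all: have t0 : 0 < t by have := lt_le_trans M0 MT; rewrite /T pmulr_lgt0 // invr_gt0 mulr_gt0 ?ltr0n.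
all: have [[i iN xi]|small] := pselect (exists2 i, i \in N & 10 * (l / t) * height i t < x i 0).
all: try by exists x; split; [exact: reach_refl|exact: below_le Gx|move=> i iN;
  rewrite (@le_trans _ _ (10 * (l / t) * height i t)) //;
  [by rewrite leNgt; apply/negP => ?; apply: small; exists i
  |rewrite ler_wpM2r ?height_ge0 ?(ltW t0) // ler_wpM2l // ler_pM2r // invr_gt0]].
(* With no heavy coordinate left, another fast step is impossible. *)
- have [x' [_ _]] := fast_step n0 s0 pol fV Vmax Gx GT sl (le_trans lM' MT) (ex_intro2 _ _ i iN xi).
  by rewrite ltnNge (leq_trans hk).
have [x' [xx' Gx' hk']] := fast_step n0 s0 pol fV Vmax Gx GT sl (le_trans lM' MT) (ex_intro2 _ _ i iN xi).
have [|||||y [x'y Ty yN]] := IH (40 * nu ^+ 2 * l) (G + 24 * nu ^+ 2 * l) x' Gx'.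
- by rewrite -ltnS (leq_trans hk').
- by apply: le_trans sl _; rewrite ler_peMl ?(ltW l0) //; lra.
- by apply: le_trans lM; rewrite [_ ^+ k.+1]exprS mulrA [40 * _ * l]mulrC.
- by [].
- apply: le_trans GM; rewrite (_ : k.+1%:R = k%:R + 1); last by rewrite natr1.
  rewrite mulrDl mul1r.
  have : 24 * nu ^+ 2 * l <= 24 * nu ^+ 2 * M.
    by rewrite ler_wpM2l // mulr_ge0 ?ler0n ?exprn_ge0.
  by lra.
by exists y; split => //; right; exists x'.
Qed.

(** From the lowest admissible level [184 * nu ^+ 2 * s], [n] rounds lead to level [M]. Then each
    coordinate in [N] costs at most [10 * M] and each other one at most [4 * s], in total at most
    [Gam * s]. *)
Lemma fast_walk N s t Gam x V : (0 < n)%N -> 0 < s -> polarized N s t ->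
  free_space N t V -> (forall V', free_space N s V' -> (\rank V' <= \rank V)%N) ->
  184 * 10 * nu ^+ 3 * (40 * nu ^+ 2) ^+ n <= Gam -> Gam ^+ 3 * s <= t ->
  below (t / Gam) x -> exists2 x', reach A b n x x' & below (Gam * s) x'.
Proof.
move=> n0 s0 pol fV Vmax GamL Gamt Gx.
have nu1 : 1 <= nu by rewrite ler1n.
have nu2 : 1 <= nu ^+ 2 by rewrite exprn_ege1.
have nu3 : 1 <= nu ^+ 3 by rewrite exprn_ege1.
set Q := (40 * _) ^+ n in GamL.
have Q1 : 1 <= Q by rewrite exprn_ege1 //; lra.
have Gam1 : 184 * 10 * nu ^+ 3 <= Gam by apply: le_trans GamL; rewrite ler_peMr // !mulr_ge0 ?ler0n ?exprn_ge0.
have Gam0 : 0 < Gam by apply: lt_le_trans Gam1; lra.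
have t0 : 0 < t by apply: lt_le_trans Gamt; rewrite mulr_gt0 ?exprn_gt0.
pose M := 184 * nu ^+ 2 * s * Q.
have M0 : 0 <= M by rewrite !mulr_ge0 ?exprn_ge0 // ltW.
have M1 : 10 * nu * M <= Gam * s.
  rewrite (_ : 10 * nu * M = 184 * 10 * nu ^+ 3 * Q * s); last by rewrite /M; ring.
  by rewrite ler_pM2r.
have M2 : M * (24 * 256 * nu ^+ 6) <= t.
  have H1 : M <= Gam * s by apply: le_trans M1; rewrite ler_peMl //; lra.
  have H2 : 24 * 256 * nu ^+ 6 <= Gam ^+ 2.
    have -> : nu ^+ 6 = nu ^+ 3 ^+ 2 by rewrite -exprM.
    by nra.
  apply: le_trans Gamt; rewrite (_ : Gam ^+ 3 * s = Gam * s * Gam ^+ 2); last by ring.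
  apply: (ler_pM M0 _ H1 H2); apply: mulr_ge0; last exact/exprn_ge0/ltW/(lt_le_trans ltr01).
  by apply: mulr_ge0; exact: ler0n.
have [|//||||x' [xx' Tx' x'N]] := @fast_walk_rec n N s t (184 * nu ^+ 2 * s) M (t / Gam) x V n0 s0 pol fV Vmax Gx.
- by apply: leq_trans (max_card _) _; rewrite card_ord.
- by [].
- rewrite ler_pdivlMr; last by lra.
  apply: le_trans M2; rewrite ler_wpM2l //.
  have -> : nu ^+ 6 = nu ^+ 3 * nu ^+ 3 by rewrite -exprD.
  by nra.
(* The initial gap and the total overshoot each take at most half of the allowed gap. *)
- have H1 : t / Gam <= t / (256 * nu ^+ 3).
    apply: ler_wpM2l; first exact: ltW.
    by rewrite lef_pV2 ?posrE; lra.
  have H2 : nu * (24 * nu ^+ 2 * M) <= t / (256 * nu ^+ 3).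
    rewrite ler_pdivlMr; last by lra.
    by apply: le_trans M2; rewrite le_eqVlt; apply/orP; left; apply/eqP; ring.
  have -> : t / (128 * nu ^+ 3) = t / (256 * nu ^+ 3) + t / (256 * nu ^+ 3).
    by field; rewrite gt_eqF //; lra.
  exact: lerD.
exists x' => //; split; first by case: Tx'.
have Tt : t / (128 * nu ^+ 3) <= t.
  by rewrite ler_pdivrMr ?ler_peMr ?(ltW t0) //; lra.
apply: le_trans M1; rewrite (_ : 10 * nu * M = \sum_(i < n) (10 * M)); last first.
  by rewrite sumr_const card_ord -(mulr_natr (10 * M)); ring.
apply: ler_sum => i _; have [iN|iN] := boolP (i \in N).
  apply: le_trans (ler_wpM2l (c_ge0 i) (x'N i iN)) _.
  rewrite mulrCA; apply: (@le_trans _ _ (10 * (M / t) * t)).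
    rewrite ler_wpM2l ?cost_height ?(ltW t0) //.
    by apply: mulr_ge0; [exact: ler0n|exact: divr_ge0 (ltW t0)].
  by rewrite mulrA divfK ?gt_eqF.
apply: (@le_trans _ _ (4 * s)).
  apply: le_trans (ler_wpM2l (c_ge0 i) (le_trans (height_ub i (below_le Tt Tx')) (proj2 pol i iN))) _.
  rewrite mulrCA; apply: ler_wpM2l => //; exact: cost_height (ltW s0).
have : s * 1 <= s * (nu ^+ 2 * Q) by apply: ler_wpM2l (ltW s0) _ _ _; exact: mulr_ege1.
have -> : M = 184 * (s * (nu ^+ 2 * Q)) by rewrite /M; ring.
lra.
Qed.

Lemma mass_setD D (H : {set 'I_n}) g d : (forall i, i \in H -> d 0 i = 0) ->
  mass (D :\: H) g d = mass D g d.
Proof.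
move=> dH; rewrite /mass big_mkcond [RHS]big_mkcond; apply: eq_bigr => i _.
rewrite inE; have [iH|] /= := boolP (i \in H); last by [].
by rewrite dH // mul0r expr0n if_same.
Qed.

Lemma free_space0 N g : free_space N g 0.
Proof.
move=> d; rewrite submx0 => /eqP ->; split.
- by rewrite trmx0 mulmx0.
- by move=> i _; rewrite mxE.
- have m0 D : mass D g 0 = 0.
    by rewrite /mass big1 // => i _; rewrite mxE mul0r expr0n.
  by rewrite !m0.
Qed.

Definition free_dim N g : nat :=
  \max_(r < n.+1 | `[< exists2 V, free_space N g V & \rank V = r >]) r.

Lemma free_dim_max N g V : free_space N g V -> (\rank V <= free_dim N g)%N.
Proof.
move=> fV; have rV : (\rank V < n.+1)%N by rewrite ltnS rank_leq_row.
by apply: (@leq_bigmax_cond _ _ _ (Ordinal rV)); apply/asboolP; exists V.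
Qed.

Lemma free_dim_attained N g : exists2 V, free_space N g V & \rank V = free_dim N g.
Proof.
rewrite /free_dim; apply: (big_ind (fun r => exists2 V, free_space N g V & \rank V = r)).
- by exists 0; [exact: free_space0|exact: mxrank0].
- by move=> p q [V fV <-] [W fW <-]; case: leqP => _; [exists W|exists V].
- by move=> r /asboolP.
Qed.

Lemma free_dim_leq N g : (free_dim N g <= n)%N.
Proof. by have [V _ <-] := free_dim_attained N g; exact: rank_leq_row. Qed.

Lemma rank_diag_indicator (H : {set 'I_n}) :
  (\rank (diag_mx (\row_i (i \in H)%:R) : 'M[R]_n) <= #|H|)%N.
Proof.
have -> : diag_mx (\row_i (i \in H)%:R) = \sum_(i in H) delta_mx i i :> 'M[R]_n.
  apply/matrixP => i j; rewrite !mxE summxE big_mkcond (bigD1 i) //= big1 ?addr0.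
    by rewrite mxE eqxx /= eq_sym; case: (i \in H); case: eqP.
  by move=> k ki; case: ifP => // _; rewrite mxE eq_sym (negPf ki).
rewrite -sum1_card; elim/big_rec2: _ => [|i k M iH Mk]; first by rewrite mxrank0.
by apply: leq_trans (mxrank_add _ _) _; rewrite mxrank_delta leq_add.
Qed.

(** Requiring the vectors of an optimal space to vanish on [H] costs at most [#|H|] dimensions. What
    remains is free at [s], since off [H] the types agree and [mass_flat] and [mass_steep] apply. *)
Lemma free_dim_drop N N' (H : {set 'I_n}) s t : 0 < s -> 16 * s <= t ->
  (forall i, i \notin H -> (i \in N') = (i \in N)) ->
  (forall i, i \in N -> i \notin H -> t * height i s <= 4 * (s * height i t)) ->
  (forall i, i \notin N -> i \notin H -> height i t <= 4 * height i s) ->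
  (free_dim N t <= free_dim N' s + #|H|)%N.
Proof.
move=> s0 st NN' HN HB; have st' : s <= t by lra.
have t0 : 0 < t by lra.
have [V fV <-] := free_dim_attained N t.
pose S : 'M[R]_n := diag_mx (\row_i (i \in H)%:R).
pose W := (V :&: kermx S)%MS.
suff /free_dim_max WN' : free_space N' s W.
  rewrite -(mxrank_mul_ker V S) addnC leq_add //.
  exact: leq_trans (mxrankM_maxr _ _) (rank_diag_indicator H).
move=> d; rewrite sub_capmx => /andP[/fV[Ad d0 dBN] /sub_kermxP dS].
have dH i : i \in H -> d 0 i = 0.
  move=> iH; have := congr1 (fun M : 'rV[R]_n => M 0 i) dS.
  by rewrite mul_mx_diag !mxE iH mulr1.
split => //; first by move=> i /(height_eq0 s0 t0)/d0.
have NE : N' :\: H = N :\: H.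
  by apply/setP => i; rewrite !inE; case: (boolP (i \in H)) => //= /NN'.
have NE' : ~: N' :\: H = ~: N :\: H.
  by apply/setP => i; rewrite !inE; case: (boolP (i \in H)) => //= /NN' ->.
rewrite -(mass_setD (~: N') s dH) -(mass_setD N' s dH) NE NE'.
have m1 : mass (~: N :\: H) s d <= 16 * mass (~: N :\: H) t d.
  by apply: mass_flat => // i; rewrite !inE => /andP[? ?]; exact: HB.
have m2 : (t / (4 * s)) ^+ 2 * mass (N :\: H) t d <= mass (N :\: H) s d.
  by apply: mass_steep => // i; rewrite !inE => /andP[? ?]; exact: HN.
move: m1 m2; rewrite !mass_setD // => m1 m2.
have ts : 4 <= t / (4 * s) by rewrite ler_pdivlMr ?mulr_gt0 ?ltr0n //; lra.
apply: le_trans m1 _; apply: le_trans m2.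
apply: (@le_trans _ _ (16 * mass N t d)); first by rewrite ler_wpM2l.
by rewrite ler_wpM2r ?mass_ge0 //; move: ts; set q := t / _; nra.
Qed.

(** * Amortization over a geometric grid of gaps *)

Section Grid.
Context (E : 'I_n -> seq R) (g0 Gam : R) (T0 : nat).
Context (E_dichotomy : forall i s t, 0 < s -> s <= t ->
  (forall e : R, e \in E i -> ~~ (s < e < t)) ->
  height i t <= 4 * height i s \/ t * height i s <= 4 * (s * height i t)).
Context (n_gt0 : (0 < n)%N) (g0_gt0 : 0 < g0).
Context (Gam_large : 184 * 10 * nu ^+ 3 * (40 * nu ^+ 2) ^+ n <= Gam).
Context (T0_large : (1 - nu^-1) ^+ T0 * Gam <= 1).

Definition grid k : R := g0 / Gam ^+ k.

Lemma Gam_gt16 : 16 < Gam.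
Proof.
have nu1 : 1 <= nu by rewrite ler1n.
have nu2 : 1 <= nu ^+ 2 by rewrite exprn_ege1.
have nu3 : 1 <= nu ^+ 3 by rewrite exprn_ege1.
apply: lt_le_trans Gam_large.
have Q1 : 1 <= (40 * nu ^+ 2) ^+ n by rewrite exprn_ege1 //; lra.
have : 1 <= nu ^+ 3 * (40 * nu ^+ 2) ^+ n by exact: mulr_ege1.
by rewrite -!mulrA; lra.
Qed.

Lemma Gam_gt0 : 0 < Gam.
Proof. by have := Gam_gt16; lra. Qed.

Lemma grid_gt0 k : 0 < grid k.
Proof. by rewrite divr_gt0 ?exprn_gt0 ?Gam_gt0. Qed.

Lemma gridS k : grid k = Gam * grid k.+1.
Proof.
have G0 := Gam_gt0; have Gk : 0 < Gam ^+ k by exact: exprn_gt0.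
by rewrite /grid [Gam ^+ k.+1]exprS; field; rewrite !gt_eqF.
Qed.

Lemma grid_le i j : (i <= j)%N -> grid j <= grid i.
Proof.
move=> ij; rewrite -(subnK ij); elim: (j - i)%N => [|k IH]; first by rewrite add0n.
rewrite addSn; apply: le_trans IH; rewrite [leRHS]gridS ler_peMl ?(ltW (grid_gt0 _)) //.
by have := Gam_gt16; lra.
Qed.

(** The set [N] at scale [k], read off from a single grid interval. *)
Definition steep k : {set 'I_n} :=
  [set i | 4 * height i (grid k.+1) < height i (grid k)]%SET.
(** Two grid intervals, because [steep k.+1] already involves the heights at [grid k.+2]. *)
Definition hit k : {set 'I_n} :=
  [set i | has (fun e : R => grid k.+2 < e <= grid k) (E i)]%SET.
Definition dim k : nat := free_dim (steep k) (grid k).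
Definition active k : bool := (0 < #|hit k|)%N || (dim k.+1 != dim k).

(** Consecutive windows overlap, so together they cover everything from [grid j.+1] to [grid i]. *)
Lemma not_hit a i j : (i < j)%N -> (forall k, (i <= k < j)%N -> a \notin hit k) ->
  forall e : R, e \in E a -> ~~ (grid j.+1 < e <= grid i).
Proof.
move=> ij; rewrite -(subnK ij); elim: (j - i.+1)%N => [|k IH] H e eE.
  have := H i; rewrite add0n leqnn ltnSn => /(_ isT); rewrite inE => /hasPn; exact.
have [ke|ek] := ltP (grid (k + i.+1).+1) e.
  have := IH _ e eE; rewrite ke /= => IH'.
  rewrite negb_and IH' ?orbT // => l /andP[il lk]; apply: H.
  by rewrite il /= (ltn_trans lk) // addSn.
have := H (k + i.+1)%N; rewrite addSn ltnSn andbT => /(_ (ltnW (leq_addl _ _))).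
have ek' : e <= grid (k + i.+1) := le_trans ek (grid_le (leqnSn _)).
by rewrite inE => /hasPn /(_ e eE); rewrite ek' andbT negb_and => ->.
Qed.

(** The factor 4 is not lost on a smaller range, because [height a g / g] is monotone in [g]. *)
Lemma steep_sub a s s' t' t : 0 < s -> s <= s' -> s' <= t' -> t' <= t ->
  t * height a s <= 4 * (s * height a t) -> t' * height a s' <= 4 * (s' * height a t').
Proof.
move=> s0 ss' st' tt' H.
have s'0 := lt_le_trans s0 ss'; have t'0 := lt_le_trans s'0 st'; have t0 := lt_le_trans t'0 tt'.
have H1 := height_star a s0 ss'; have H2 := height_star a t'0 tt'.
rewrite -(ler_pM2l (mulr_gt0 s0 t0)).
have : t * t' * (s * height a s') <= t * t' * (s' * height a s) by rewrite ler_pM2l ?mulr_gt0.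
have : s' * t' * (t * height a s) <= s' * t' * (4 * (s * height a t)) by rewrite ler_pM2l ?mulr_gt0.
have : 4 * s * s' * (t' * height a t) <= 4 * s * s' * (t * height a t') by rewrite ler_pM2l ?mulr_gt0 ?ltr0n.
by move=> ? ? ?; lra.
Qed.

(** The dichotomy is applied down to [grid j.+1]. As [Gam > 16], a nonzero proportional height drops
    by a factor above 4 at each grid step, so [steep] tells the two cases apart. *)
Lemma coordinate_type a i j : (i < j)%N ->
  (forall k, (i <= k < j)%N -> a \notin hit k) ->
  (height a (grid i) <= 4 * height a (grid j) /\
     forall k, (i <= k <= j)%N -> a \notin steep k) \/
  (grid i * height a (grid j) <= 4 * (grid j * height a (grid i)) /\
     forall k, (i <= k <= j)%N -> a \in steep k).
Proof.
move=> ltij /(not_hit ltij) HE; have ij := ltnW ltij.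
have mono k l : (k <= l)%N -> height a (grid l) <= height a (grid k).
  by move=> kl; apply: height_mono (ltW (grid_gt0 _)) (grid_le kl).
have [flat|nflat] := leP (height a (grid i)) (4 * height a (grid j.+1)).
  left; split; first by apply: le_trans flat _; rewrite ler_pM2l ?ltr0n // mono.
  move=> k /andP[ik kj]; rewrite inE -leNgt.
  apply: le_trans (mono _ _ ik) _; apply: le_trans flat _.
  by rewrite ler_pM2l ?ltr0n // mono.
right.
have prop : grid i * height a (grid j.+1) <= 4 * (grid j.+1 * height a (grid i)).
  have [|H|//] := @E_dichotomy a (grid j.+1) (grid i) (grid_gt0 _) (grid_le (leqW ij)).
    by move=> e eE; apply: contra (HE e eE) => /andP[-> /ltW].
  by move: nflat; rewrite ltNge H.
split; first exact: steep_sub (grid_gt0 _) (grid_le (leqnSn j)) (grid_le ij) (lexx _) prop.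
move=> k /andP[ik kj]; rewrite inE.
have H : grid k * height a (grid k.+1) <= 4 * (grid k.+1 * height a (grid k)).
  exact: steep_sub (grid_gt0 _) (grid_le _) (grid_le (leqnSn k)) (grid_le ik) prop.
have hk : 0 < height a (grid k).
  rewrite lt_neqAle height_ge0 ?(ltW (grid_gt0 _)) // andbT eq_sym.
  apply/eqP => hk; move: nflat.
  have -> := height_eq0 (grid_gt0 k) (grid_gt0 i) hk.
  by rewrite ltNge mulr_ge0 ?ler0n ?height_ge0 ?(ltW (grid_gt0 _)).
move: H; rewrite {1}gridS -mulrA mulrCA [4 * _]mulrCA ler_pM2l ?grid_gt0 //.
have := height_ge0 a (ltW (grid_gt0 k.+1)); have := Gam_gt16.
by set r := height a (grid k.+1) => ? ? ?; nra.
Qed.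

Lemma grid_drop16 k : 16 * grid k.+1 <= grid k.
Proof. by rewrite [leRHS]gridS ler_pM2r ?grid_gt0 // ltW // Gam_gt16. Qed.

Lemma dim_drop k : (dim k <= dim k.+1 + #|hit k|)%N.
Proof.
have unhit a : a \notin hit k -> forall l, (k <= l < k.+1)%N -> a \notin hit l.
  by move=> ah l; rewrite ltnS -eqn_leq => /eqP <-.
have type a := fun ah : a \notin hit k => coordinate_type (ltnSn k) (unhit a ah).
apply: free_dim_drop (grid_gt0 _) (grid_drop16 k) _ _ _.
- by move=> a /type[[_ H]|[_ H]]; [rewrite !(negPf (H _ _)) //|rewrite !H //]; rewrite ?leqnn ?leqnSn.
- move=> a aN /type[[_ H]|[//]].
  by have := H k; rewrite leqnn leqnSn aN => /(_ isT).
- move=> a aN /type[[//]|[_ H]].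
  by move: aN; rewrite H // leqnn leqnSn.
Qed.

Lemma grid_step k x : below (grid k) x ->
  exists2 y, reach A b T0 x y & below (grid k.+1) y.
Proof.
move=> /(gap_steps T0 n_gt0 (ltW (grid_gt0 k)))[y xy yg]; exists y => //.
apply: below_le yg; rewrite gridS mulrA.
by rewrite -[leRHS]mul1r ler_wpM2r ?(ltW (grid_gt0 _)).
Qed.

(** Without active indices the types and the free dimension are constant. Then [T0] steps enter the
    range, [fast_walk] crosses it and [T0] steps leave it; up to two intervals are crossed by
    [grid_step] alone. *)
Lemma run_walk i j x : (i <= j)%N -> (forall k, (i <= k < j)%N -> ~~ active k) ->
  below (grid i) x -> exists2 y, reach A b (2 * T0 + n) x y & below (grid j) y.
Proof.
move=> ij idle xi.
have [d jE] : exists d : nat, j = (d + i)%N by exists (j - i)%N; rewrite subnK.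
have [d3|] := ltnP 2 d; last first.
  case: d jE => [|[|[|//]]] -> _; first by exists x => //; exact: reach_refl.
    have [y xy yg] := grid_step xi; exists y => //.
    by apply: reach_leq xy; rewrite mul2n -addnn -addnA leq_addr.
  have [y xy yg] := grid_step xi; have [z yz zg] := grid_step yg; exists z => //.
  by apply: reach_leq (reach_trans xy yz); rewrite mul2n -addnn leq_addr.
have ltij : (i < j)%N by rewrite jE -[X in (X < _)%N]add0n ltn_add2r (ltn_trans _ d3).
have noth k a : (i <= k < j)%N -> a \notin hit k.
  by move=> /idle; rewrite negb_or -eqn0Ngt cards_eq0 => /andP[/eqP -> _]; rewrite finset.in_set0.
have type a := coordinate_type ltij (fun k => @noth k a).
have dimE k : (i <= k <= j)%N -> dim k = dim i.
  move=> /andP[ik]; rewrite -(subnK ik); elim: (k - i)%N => [|l IH] H; first by rewrite add0n.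
  rewrite addSn -IH; last by rewrite (leq_trans _ H) // addSn.
  have := idle (l + i)%N; rewrite leq_addl -addSn H => /(_ isT).
  by rewrite negb_or negbK => /andP[_ /eqP].
have steepE : steep j = steep i.
  apply/setP => a; have [[_ H]|[_ H]] := type a; last by rewrite !H ?leqnn ?ij.
  by rewrite !(negPf (H _ _)) ?leqnn ?ij.
have pol : polarized (steep i) (grid j) (grid i).
  split=> a aN; have [[H1 H]|[H1 H]] := type a => //.
    by have := H i; rewrite leqnn ij aN => /(_ isT).
  by move: aN; rewrite H // leqnn ij.
have [V fV rV] := free_dim_attained (steep i) (grid i).
have Vmax V' : free_space (steep i) (grid j) V' -> (\rank V' <= \rank V)%N.
  rewrite rV -steepE => /free_dim_max; rewrite -/(dim j) dimE ?ij ?leqnn //.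
  by rewrite /dim steepE.
have [y xy yg] := grid_step xi.
have [z yz zg] : exists2 z, reach A b n y z & below (grid j.-1) z.
  have jS : j.-1.+1 = j by rewrite prednK // (leq_ltn_trans _ ltij).
  have [||z yz zg] := fast_walk n_gt0 (grid_gt0 j) pol fV Vmax Gam_large _ _ (x := y).
  - rewrite (_ : Gam ^+ 3 * grid j <= grid i) // (gridS i) (gridS i.+1) (gridS i.+2).
    rewrite (_ : Gam * _ = Gam ^+ 3 * grid i.+3); last by ring.
    by rewrite ler_pM2l ?exprn_gt0 ?Gam_gt0 // grid_le // jE; lia.
  - by rewrite gridS mulrAC divff ?mul1r ?gt_eqF ?Gam_gt0.
  by exists z; rewrite // gridS jS.
have [w zw wg] := grid_step zg.
exists w; last by move: wg; rewrite prednK // (leq_ltn_trans _ ltij).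
rewrite mul2n -addnn addnAC.
by apply: reach_trans zw; apply: reach_trans xy yz.
Qed.

(** Induction keeps a point at the start [i] of the current idle run. An active index costs one
    [run_walk] to reach it and one [grid_step] to pass it; a last run ends at [j]. *)
Lemma walk_to_grid j x : below (grid 0) x ->
  exists2 y, reach A b ((2 * T0 + n) * (1 + 2 * \sum_(k < j) active k)) x y & below (grid j) y.
Proof.
move=> x0; set K := (2 * T0 + n)%N.
have [i [ij idle [y xy yi]]] : exists i, [/\ (i <= j)%N,
    forall k, (i <= k < j)%N -> ~~ active k &
    exists2 y, reach A b (K * (2 * \sum_(k < j) active k)) x y & below (grid i) y].
  elim: j => [|j [i [ij idle [y xy yi]]]].
    by exists 0%N; split => //; exists x => //; exact: reach_refl.
  rewrite big_ord_recr /=; have [act|nact] := boolP (active j).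
    have [z yz zj] := run_walk ij idle yi; have [w zw wj] := grid_step zj.
    exists j.+1; split => //; first by move=> k; rewrite ltnNge andbC andbN.
    exists w => //; set S := (\sum_(k < j) _)%N in xy *.
    have T0K : (T0 <= K)%N by rewrite /K; lia.
    apply: (@reach_leq _ _ _ _ _ (K * (2 * S) + K + T0)); first by nia.
    exact: reach_trans (reach_trans xy yz) zw.
  exists i; split; first exact: leqW.
    move=> k /andP[ik]; rewrite ltnS leq_eqVlt => /orP[/eqP -> //|kj].
    by apply: idle; rewrite ik.
  by exists y; rewrite // addn0.
have [z yz zj] := run_walk ij idle yi; exists z => //.
by rewrite mulnDr muln1 addnC; exact: reach_trans xy yz.
Qed.

(** With [dim] as potential: by [dim_drop], an active index without hits raises [dim], and one with
    hits lowers it by at most their number. *)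
Lemma count_active j :
  (\sum_(k < j) active k + dim 0 <= 2 * \sum_(k < j) #|hit k| + dim j)%N.
Proof.
elim: j => [|j IH]; first by rewrite !big_ord0.
rewrite !big_ord_recr /=.
have : (active j + dim j <= 2 * #|hit j| + dim j.+1)%N.
  have := dim_drop j; rewrite /active.
  by have [h|h] := posnP #|hit j|; have [d|/eqP d] := eqVneq (dim j.+1) (dim j); lia.
move: IH; move: (\sum_(k < j) active k)%N (\sum_(k < j) #|hit k|)%N => p q.
by move: #|hit j| (nat_of_bool _) (dim 0) (dim j) (dim j.+1) => *; lia.
Qed.

(* Each point lies in at most two of the windows ]g_(k+2), g_k], which telescope. *)
Lemma count_point (e : R) j :
  (\sum_(k < j) (grid k.+2 < e <= grid k)%R + (e <= grid j)%R + (e <= grid j.+1)%R <= 2)%N.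
Proof.
elim: j => [|j IH]; first by rewrite big_ord0; do 2!case: (_ <= _).
rewrite big_ord_recr /=; move: IH.
have := grid_le (leqW (leqnSn j)).
case: (leP e (grid j)) => ej; case: (leP e (grid j.+2)) => ejj /=; try lia.
by move=> H; move: (le_trans ejj H); rewrite leNgt ej.
Qed.

Lemma count_hit j : (\sum_(k < j) #|hit k| <= 2 * \sum_i size (E i))%N.
Proof.
have hitE k : (#|hit k| <= \sum_i \sum_(e <- E i) (grid k.+2 < e <= grid k)%R)%N.
  rewrite -sum1_card big_mkcond; apply: leq_sum => i _; rewrite inE.
  by case: hasP => // -[e eE ek]; rewrite (big_rem e eE) /= ek.
apply: leq_trans (leq_sum _ _) _ => [k _|]; first exact: hitE.
rewrite exchange_big big_distrr /=; apply: leq_sum => i _.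
rewrite exchange_big /= -sum1_size big_distrr /=; apply: leq_sum => e _.
by apply: leq_trans (count_point e j); rewrite -addnA leq_addr.
Qed.

(** Since [dim] is at most [n] and each breakpoint causes at most two hits, the number of steps does
    not depend on [eps]. *)
Lemma walk_below x (eps : R) : below g0 x -> 0 < eps ->
  exists2 y, reach A b ((2 * T0 + n) * (1 + 2 * (4 * \sum_i size (E i) + n))) x y & below eps y.
Proof.
move=> x0 eps0.
have [j je] : exists j, grid j <= eps.
  exists (Num.bound (g0 / eps)); rewrite /grid ler_pdivrMr ?exprn_gt0 ?Gam_gt0 // mulrC -ler_pdivrMr //.
  apply: le_trans (ltW (upper_nthrootP (leqnn _))) _.
  by apply: lerXn2r; rewrite ?nnegrE ?(ltW Gam_gt0) //; have := Gam_gt16; lra.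
have [|y xy yj] := @walk_to_grid j x; first by rewrite /grid expr0 divr1.
exists y; last exact: below_le yj.
apply: reach_leq xy; rewrite leq_mul2l leq_add2l leq_mul2l /=; apply/orP; right.
have := count_active j; have := count_hit j; have := free_dim_leq (steep j) (grid j).
rewrite -/(dim j).
move: (\sum_(k < j) active k)%N (\sum_(k < j) #|hit k|)%N (\sum_i size (E i))%N.
by move: (dim 0) (dim j) => *; lia.
Qed.

End Grid.

(** Only finitely many points are within [T] steps, so their positive gaps are bounded below by some
    [del]. *)
Lemma reach_gap0 T x : P x ->
  (forall eps : R, 0 < eps -> exists2 y, reach A b T x y & below eps y) ->
  exists y, [/\ reach A b T x y, P y & inner c y = 0].
Proof.
move=> Px H; have /finite_seqP[ys ysE] := reach_finite A b T x.
have [del del0 delH] : exists2 del : R, 0 < del &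
    forall y, y \in ys -> 0 < inner c y -> del <= inner c y.
  elim: ys {ysE} => [|y ys [del del0 delH]]; first by exists 1.
  have [gy|gy] := ltP 0 (inner c y).
    exists (Num.min del (inner c y)); first by rewrite lt_min del0.
    move=> z; rewrite inE => /orP[/eqP -> _|zys gz]; first by rewrite ge_min lexx orbT.
    by rewrite ge_min delH.
  exists del => // z; rewrite inE => /orP[/eqP ->|]; last exact: delH.
  by rewrite ltNge gy.
have [|y xy [Py gy]] := H (del / 2); first by lra.
exists y; split => //; apply/le_anti/andP; split; last exact: gap_ge0 Py.
have yys : y \in ys by have : [set y | reach A b T x y] y by []; rewrite ysE.
rewrite leNgt; apply/negP => gy0; have := delH y yys gy0.
by move: gy; lra.
Qed.

End MaxCentralPath.

(** * Regimes of a piecewise linear approximation *)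

Section StraightLineComplexityFacts.
Context {R : realType}.
Implicit Types (phi psi : R -> R).

(* On a piece [a g + d] with [a, d > 0], the extra breakpoint [d / a] separates the
   part where [d] dominates from the part where [a g] does. *)
Lemma piecewise_dichotomy k phi psi : piecewise_linear k psi ->
  (forall g, 0 <= g -> 0 <= psi g) ->
  (forall g, 0 <= g -> 2^-1 * phi g <= psi g <= phi g) ->
  exists2 E : seq R, (size E <= 2 * k)%N & forall s t, 0 < s -> s <= t ->
    (forall e, e \in E -> ~~ (s < e < t)) ->
    phi t <= 4 * phi s \/ t * phi s <= 4 * (s * phi t).
Proof.
move=> [k0 _ [tt [tt0 _ lin]]] psi0 psiphi.
have /choice[ad adH] : forall j, exists ad : R * R, (j < k)%N -> forall g,
    tt j <= g -> ((j.+1 < k)%N -> g <= tt j.+1) -> psi g = ad.1 * g + ad.2.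
  move=> j; have [jk|] := ltnP j k; last by exists (0, 0).
  by have [a [d H]] := lin j jk; exists (a, d).
exists ([seq tt j | j <- iota 0 k] ++ [seq (ad j).2 / (ad j).1 | j <- iota 0 k]).
  by rewrite size_cat !size_map size_iota mul2n addnn.
move=> s t s0 st HE; have t0 := lt_le_trans s0 st.
have inE1 j : (j < k)%N -> ~~ (s < tt j < t).
  by move=> jk; apply: HE; rewrite mem_cat map_f // mem_iota.
have inE2 j : (j < k)%N -> ~~ (s < (ad j).2 / (ad j).1 < t).
  move=> jk; apply: HE; rewrite mem_cat; apply/orP; right.
  by apply: (map_f (fun j => (ad j).2 / (ad j).1)); rewrite mem_iota.
(* The last piece starting at or before [s] also contains [t], as no breakpoint lies strictly
   between them. *)
have [j [jk js jmax]] : exists j, [/\ (j < k)%N, tt j <= s & (j.+1 < k)%N -> t <= tt j.+1].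
  have exj : exists j, (j < k)%N && (tt j <= s) by exists 0%N; rewrite k0 tt0 ltW.
  have exb j : (j < k)%N && (tt j <= s) -> (j <= k)%N by move=> /andP[/ltnW].
  have [j /andP[jk js] jmax] := ex_maxnP exj exb.
  exists j; split => // jk'; rewrite leNgt; apply/negP => jt.
  have := inE1 _ jk'; rewrite jt andbT -leNgt => js'.
  by have := jmax j.+1; rewrite jk' js' ltnn => /(_ isT).
have psis : psi s = (ad j).1 * s + (ad j).2.
  by apply: adH => // /jmax; exact: le_trans.
have psit : psi t = (ad j).1 * t + (ad j).2.
  by apply: adH => //; exact: le_trans st.
have := inE2 j jk; move: psis psit; case: (ad j) => a d /= psis psit.
have := psi0 s (ltW s0); have := psi0 t (ltW t0).
have /andP[s1 s2] := psiphi s (ltW s0); have /andP[t1 t2] := psiphi t (ltW t0).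
move=> pt0 ps0.
(* One factor 2 comes from the regime of [psi], the other from the approximation of [phi] by
   [psi]. *)
have flat : psi t <= 2 * psi s -> phi t <= 4 * phi s by lra.
have prop : t * psi s <= 2 * (s * psi t) -> t * phi s <= 4 * (s * phi t).
  move=> H; have : t * (2^-1 * phi s) <= t * psi s by rewrite ler_pM2l.
  have : s * psi t <= s * phi t by rewrite ler_pM2l.
  by lra.
have [a0|a0] := leP a 0; first by move=> _; left; apply: flat; nra.
have [d0|d0] := leP d 0; first by move=> _; right; apply: prop; rewrite psis psit; nra.
rewrite negb_and -!leNgt ler_pdivrMr // ler_pdivlMr // => /orP[das|dat].
  by right; apply: prop; rewrite psis psit; nra.
have as0 : 0 <= a * s by rewrite mulr_ge0 ?ltW.
by left; apply: flat; rewrite psis psit; lra.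
Qed.

Lemma SLC_attained (eta : R) phi : SLC eta phi = +oo%E \/
  exists2 k, SLC eta phi = (k%:R)%:E & exists psi,
    [/\ piecewise_linear k psi, forall g, 0 <= g -> 0 <= psi g &
        forall g, 0 <= g -> eta * phi g <= psi g <= phi g].
Proof.
pose Q k := exists psi, [/\ piecewise_linear k psi, forall g, 0 <= g -> 0 <= psi g &
        forall g, 0 <= g -> eta * phi g <= psi g <= phi g].
have [[k0 Qk0]|nQ] := pselect (exists k, Q k); last first.
  left; rewrite /SLC (_ : [set _ | _ in _] = set0) ?ereal_inf0 //.
  by apply/seteqP; split => // y [k Qk _]; apply: nQ; exists k.
right; have exk : exists k, `[< Q k >] by exists k0; apply/asboolP.
have [k /asboolP Qk kmin] := ex_minnP exk.
exists k => //; apply/le_anti/andP; split; first by apply: ereal_inf_lbound; exists k.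
apply: le_ereal_inf_tmp => _ [l Ql <-]; rewrite lee_fin ler_nat.
by apply: kmin; apply/asboolP.
Qed.

End StraightLineComplexityFacts.

(** * The cost vector of a vertex *)

Section VertexCost.
Context {R : realType} {m n : nat} (A : 'M[R]_(m, n)) (b : 'cV[R]_m) (v : 'cV[R]_n).
Implicit Types (x d : 'cV[R]_n).
Local Notation P := (polyhedron A b).
Context (v_vertex : is_vertex P v).

Definition vertex_cost : 'cV[R]_n := \col_i (v i 0 == 0)%:R.
Local Notation c := vertex_cost.

Lemma vertex_cost_ge0 i : 0 <= c i 0.
Proof. by rewrite mxE ler0n. Qed.

Lemma vertex_gap : inner c v = 0.
Proof.
rewrite /inner big1 // => i _; rewrite mxE.
by have [->|_] := eqVneq (v i 0) 0; rewrite ?mulr0 ?mul0r.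
Qed.

(** For small [eps] both [v + eps *: d] and [v - eps *: d] are feasible with midpoint [v], so
    extremality gives [d = 0]. *)
Lemma vertex_kernel d : A *m d = 0 -> (forall i, v i 0 = 0 -> d i 0 = 0) -> d = 0.
Proof.
move=> Ad dv; have [[Av v0] vext] := v_vertex.
have [eps eps0 epsH] : exists2 eps : R, 0 < eps & forall i, eps * `|d i 0| <= v i 0.
  pose f i := if v i 0 == 0 then 1 else v i 0 / (`|d i 0| + 1).
  have d0 i : 0 < `|d i 0| + 1 by rewrite ltr_wpDl.
  have f0 i : 0 < f i.
    by rewrite /f; case: eqVneq => // vi; rewrite divr_gt0 // lt_neqAle eq_sym vi v0.
  have S0 : 0 < 1 + \sum_i (f i)^-1.
    by rewrite ltr_wpDr // sumr_ge0 // => i _; rewrite invr_ge0 ltW.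
  (* A positive number below every [f i], without taking a minimum. *)
  exists (1 + \sum_i (f i)^-1)^-1; first by rewrite invr_gt0.
  move=> i; have ef : (1 + \sum_i (f i)^-1)^-1 <= f i.
    rewrite -[leRHS]invrK lef_pV2 ?posrE ?invr_gt0 //.
    rewrite (bigD1 i) //= addrCA lerDl addr_ge0 // sumr_ge0 // => j _.
    by rewrite invr_ge0 ltW.
  apply: (@le_trans _ _ (f i * `|d i 0|)); first by rewrite ler_wpM2r.
  rewrite /f; case: eqVneq => [vi|vi]; first by rewrite dv // normr0 mulr0 vi.
  rewrite mulrAC ler_pdivrMr // ler_wpM2l //.
  by rewrite lerDl.
have PD (e : R) : `|e| = eps -> P (v + e *: d).
  move=> ee; split; first by rewrite mulmxDr -scalemxAr Ad scaler0 addr0.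
  move=> i; rewrite !mxE; have := epsH i; rewrite -ee -normrM ler_norml.
  by case/andP; lra.
have half : 0 < (2^-1 : R) < 1 by lra.
have en : `|- eps| = eps by rewrite normrN gtr0_norm.
have [|vd _] := vext _ _ 2^-1 (PD eps (gtr0_norm eps0)) (PD (- eps) en) half.
  by apply/matrixP => i j; rewrite !mxE; field.
apply/eqP; have : eps *: d == 0 by rewrite -(addrK v (eps *: d)) addrC -[_ + v]addrC vd addNr.
by rewrite scaler_eq0 gt_eqF.
Qed.

(** By [vertex_kernel], [A] stacked on the diagonal matrix of [c] is injective. A left inverse [B]
    recovers [x - v] from entries that are 0 or of absolute value at most [inner c x]. Uniqueness of
    [v] and boundedness of the sublevel sets follow. *)
Lemma vertex_cost_bound : exists2 K : R, 0 <= K &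
  forall x i, P x -> `|x i 0 - v i 0| <= K * inner c x.
Proof.
have [[Av v0] _] := v_vertex.
pose M : 'M[R]_(m + n, n) := col_mx A (diag_mx c^T).
have Minj d : M *m d = 0 -> d = 0.
  rewrite mul_col_mx => /eqP; rewrite -[0]vsubmxK => /eqP/eq_col_mx[].
  rewrite !linear0 => Ad cd; apply: vertex_kernel => // i vi.
  have := congr1 (fun M : 'cV[R]_n => M i 0) cd.
  by rewrite mul_diag_mx !mxE vi eqxx mul1r.
have /row_freeP[B' B'E] : row_free M^T.
  apply: inj_row_free => z /(congr1 trmx); rewrite trmx_mul trmxK trmx0 => /Minj.
  by move=> /(congr1 trmx); rewrite trmxK trmx0.
pose B := B'^T.
have BM : B *m M = 1%:M by rewrite -[M]trmxK -trmx_mul B'E trmx1.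
pose K := \sum_i \sum_j `|B i j|.
exists K; first by do 2!(apply: sumr_ge0 => ? _).
move=> x i [Ax x0].
have cx j : c j 0 * x j 0 <= inner c x.
  rewrite /inner (bigD1 j) //= lerDl; apply: sumr_ge0 => l _.
  by rewrite mulr_ge0 ?vertex_cost_ge0.
have cx0 j : 0 <= c j 0 * x j 0 by rewrite mulr_ge0 ?vertex_cost_ge0.
have g0 : 0 <= inner c x by apply: sumr_ge0.
have Mx j : `|(M *m (x - v)) j 0| <= inner c x.
  rewrite mul_col_mx mulmxBr Ax Av subrr mxE.
  case: fintype.split => l; first by rewrite mxE normr0.
  rewrite mul_diag_mx !mxE.
  have [vl|_] := eqVneq (v l 0) 0; last by rewrite mul0r normr0.
  by have := cx l; have := cx0 l; rewrite !mxE vl eqxx !mul1r subr0 => /ger0_norm ->.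
have -> : x i 0 - v i 0 = (B *m (M *m (x - v))) i 0 by rewrite mulmxA BM mul1mx !mxE.
rewrite mxE; apply: le_trans (ler_norm_sum _ _ _) _.
rewrite /K (bigD1 i) //= mulrDl; apply: ler_wpDr.
  by rewrite mulr_ge0 // sumr_ge0 // => l _; apply: sumr_ge0.
rewrite mulr_suml; apply: ler_sum => j _.
by rewrite normrM ler_wpM2l.
Qed.

Lemma vertex_unique x : P x -> inner c x = 0 -> x = v.
Proof.
have [K _ KH] := vertex_cost_bound => Px gx; apply/matrixP => i j; rewrite ord1.
by apply/eqP; rewrite -subr_eq0 -normr_le0; have := KH x i Px; rewrite gx mulr0.
Qed.

Lemma vertex_below_ubound g i : has_ubound [set x i 0 | x in below A b c g].
Proof.
have [K K0 KH] := vertex_cost_bound; exists (v i 0 + K * g) => _ [x [Px gx] <-].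
have := KH x i Px; rewrite ler_norml => /andP[_].
rewrite lerBlDl => /le_trans; apply; rewrite lerD2l; exact: ler_wpM2l.
Qed.

Lemma vertex_lp_value : lp_value A b c = 0.
Proof.
have [Pv _] := v_vertex.
have lb : lbound [set inner c x | x in P] 0.
  by move=> _ [x Px <-]; apply: gap_ge0 Px => i; exact: vertex_cost_ge0.
apply/le_anti/andP; split; last by apply: lb_le_inf => //; exists (inner c v); exists v.
by apply: ge_inf; [exists 0|exists v => //; exact: vertex_gap].
Qed.

Lemma vertex_sublevel g : sublevel A b c g = below A b c g.
Proof. by rewrite /sublevel vertex_lp_value add0r. Qed.

Lemma vertex_path i : max_central_path A b c i = height A b c i.
Proof. by apply/funext => g; rewrite /max_central_path vertex_sublevel. Qed.

Lemma vertex_path_defined : max_central_path_defined A b c.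
Proof.
have [Pv _] := v_vertex; split.
  split; first by exists (inner c v); exists v.
  by exists 0 => _ [x Px <-]; apply: gap_ge0 Px => i; exact: vertex_cost_ge0.
move=> g g0; rewrite vertex_sublevel.
have [K K0 KH] := vertex_cost_bound.
exists (`|v| + K * g); split; first exact: num_real.
move=> M MK x [Px gx].
apply: le_trans (ltW MK); rewrite -[x](subrK v) addrC.
apply: le_trans (ler_normD _ _) _; rewrite lerD2l.
rewrite (_ : `|x - v| = mx_norm (x - v)) //.
have [->|/mx_norm_neq0[[k l] /= ->]] := eqVneq (mx_norm (x - v)) 0.
  by rewrite mulr_ge0 // (le_trans (gap_ge0 vertex_cost_ge0 Px)).
rewrite ord1 !mxE; apply: le_trans (KH x k Px) _; exact: ler_wpM2l.
Qed.

End VertexCost.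

(** * Choice of the scale ratio and of the step counts *)

Section Constants.
Context {R : realType}.

Lemma bernoulli (x : R) k : 0 <= x -> 1 + k%:R * x <= (1 + x) ^+ k.
Proof.
move=> x0; elim: k => [|k IH]; first by rewrite mul0r addr0 expr0.
rewrite exprS -natr1; have := ler_wpM2l (addr_ge0 ler01 x0) IH.
have : 0 <= k%:R * x * x by rewrite !mulr_ge0.
by set p := _ ^+ k; lra.
Qed.

(** Bernoulli gives [(1 + 1 / n) ^ n >= 2], and [(1 + 1 / n) (1 - 1 / n) <= 1]. *)
Lemma half_power n : (0 < n)%N -> 2 * (1 - n%:R^-1) ^+ n <= 1 :> R.
Proof.
move=> n0; have n1 : 1 <= n%:R :> R by rewrite ler1n.
have np : 0 < n%:R :> R by lra.
set x : R := n%:R^-1; have x0 : 0 <= x by rewrite invr_ge0 ltW.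
have x1 : x <= 1 by rewrite invf_le1.
have H1 : 2 <= (1 + x) ^+ n.
  by have := bernoulli n x0; rewrite /x mulfV ?gt_eqF.
have p0 : 0 <= (1 - x) ^+ n by rewrite exprn_ge0 // subr_ge0.
have : (1 + x) ^+ n * (1 - x) ^+ n <= 1.
  by rewrite -exprMn exprn_ile1 //; nra.
by have := ler_wpM2r p0 H1; lra.
Qed.

(** As [n] steps halve the gap, [T0 = n * (15 * n * L)] steps divide it by
    [Gam = 2 ^+ (15 * n * L)]. *)
Lemma gap_ratio_power n L : (0 < n)%N ->
  (1 - n%:R^-1) ^+ (n * (15 * n * L)) * 2 ^+ (15 * n * L) <= 1 :> R.
Proof.
move=> n0; rewrite exprM -exprMn mulrC exprn_ile1 //; last exact: half_power.
rewrite mulr_ge0 // exprn_ge0 // subr_ge0 invf_le1 ?ltr0n //.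
by rewrite ler1n.
Qed.

(** With [q = 2 ^ L], at least 2 and [n]: the factors are at most [q ^ 11], [q ^ 3] and
    [q ^ (8 * n)], and [14 + 8 * n <= 15 * n]. *)
Lemma scale_ratio n L : (2 <= n)%N -> (n <= 2 ^ L)%N ->
  184 * 10 * n%:R ^+ 3 * (40 * n%:R ^+ 2) ^+ n <= 2 ^+ (15 * n * L) :> R.
Proof.
move=> n2 nL; rewrite -!natrX -!natrM -natrX -natrM ler_nat.
have L0 : (0 < L)%N by case: L nL n2 => //; lia.
set q := (2 ^ L)%N in nL.
have q2 : (2 <= q)%N by rewrite /q -[X in (X <= _)%N]expn1 leq_exp2l.
have -> : (2 ^ (15 * n * L) = q ^ (11 + 3 + (8 * n) + (7 * n - 14)))%N.
  by rewrite /q -expnM; congr (2 ^ _)%N; rewrite mulnC; congr (_ * _)%N; lia.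
have q0 : (0 < q)%N by lia.
rewrite expnD; apply: (@leq_trans (q ^ (11 + 3 + 8 * n))); last by rewrite leq_pmulr // expn_gt0 q0.
rewrite (expnD q (11 + 3)) (expnD q 11); apply: leq_mul; last first.
  rewrite (expnM q 8 n) leq_exp2r; last by lia.
  apply: (@leq_trans (q ^ 6 * q ^ 2)); last by rewrite -expnD.
  apply: leq_mul; last by rewrite leq_exp2r.
  by apply: (@leq_trans (2 ^ 6)) => //; rewrite leq_exp2r.
apply: leq_mul; last by rewrite leq_exp2r.
by apply: (@leq_trans (2 ^ 11)) => //; rewrite leq_exp2r.
Qed.

Lemma up_log_ln n : (2 <= n)%N -> (up_log 2 n)%:R * ln 2 <= 2 * ln n%:R :> R.
Proof.
move=> n2; have n2' : 2 <= n%:R :> R by rewrite (ler_nat _ 2).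
have ln2n : ln 2 <= ln n%:R :> R by rewrite ler_ln ?posrE //; lra.
have [L LE] : exists L, up_log 2 n = L.+1.
  by exists (up_log 2 n).-1; rewrite prednK // up_log_gt0.
have : (2 ^ L < n)%N by have := up_log_bounds (ltnSn 1) n2; rewrite LE => /andP[].
rewrite -(ltr_nat R) natrX => Ln.
have : ln (2 ^+ L) <= ln n%:R :> R by rewrite ler_ln ?posrE ?exprn_gt0 ?ltW //; lra.
rewrite lnXn // -(mulr_natl (ln 2)) => H.
rewrite LE (_ : L.+1%:R = L%:R + 1 :> R); last by rewrite natr1.
by rewrite mulrDl mul1r; lra.
Qed.

End Constants.

(** * From gaps to the circuit diameter *)

Lemma circuit_dist_bound (R : realType) (m n : nat) (A : 'M[R]_(m, n)) (b : 'cV[R]_m)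
    (u v : 'cV[R]_n) (k : 'I_n -> nat) : (2 <= n)%N ->
  polyhedron A b u -> is_vertex (polyhedron A b) v ->
  (forall i, exists psi, [/\ piecewise_linear (k i) psi, forall g, 0 <= g -> 0 <= psi g &
     forall g, 0 <= g -> 2^-1 * max_central_path A b (vertex_cost v) i g <= psi g <=
       max_central_path A b (vertex_cost v) i g]) ->
  (circuit_dist A b u v <=
    ((31 * 19 * (up_log 2 n * n ^ 2 * \sum_i k i))%N%:R : R)%:E)%E.
Proof.
move=> n2 Pu vV kpsi; set c := vertex_cost v in kpsi.
have n0 : (0 < n)%N by exact: ltnW.
have [Pv _] := vV; have c0 := vertex_cost_ge0 v.
have k0 i : (0 < k i)%N by have [psi [[]]] := kpsi i.
have /choice[E EH] : forall i, exists E : seq R, (size E <= 2 * k i)%N /\ forall s t,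
    0 < s -> s <= t -> (forall e, e \in E -> ~~ (s < e < t)) ->
    height A b c i t <= 4 * height A b c i s \/
    t * height A b c i s <= 4 * (s * height A b c i t).
  move=> i; have [psi [lin psi0 psiphi]] := kpsi i.
  have [E E1 E2] := piecewise_dichotomy lin psi0 psiphi; exists E.
  by move: E2; rewrite (vertex_path vV).
have [T TK uv] : exists2 T, (T <= 31 * 19 * (up_log 2 n * n ^ 2 * \sum_i k i))%N & reach A b T u v.
  have [gu|gu] := leP (inner c u) 0.
    exists 0%N => //; left; apply: (vertex_unique vV Pu).
    by apply/le_anti; rewrite gu (gap_ge0 c0 Pu).
  set L := up_log 2 n; pose T0 := (n * (15 * n * L))%N.
  set T := (_ * _)%N.
  exists T => //.
  have nL : (n <= 2 ^ L)%N by exact: up_logP.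
  have [|y [uy Py gy]] := @reach_gap0 _ _ _ A b c c0 T u Pu; last first.
    by rewrite -(vertex_unique vV Py gy).
  move=> eps eps0.
  have ubd := vertex_below_ubound vV.
  have EH2 i := proj2 (EH i).
  have Gu : below A b c (inner c u) u by split.
  have [y uy ye] := walk_below c0 Pv (vertex_gap v) ubd EH2 n0 gu (scale_ratio n2 nL)
    (gap_ratio_power L n0) Gu eps0.
  exists y => //; apply: reach_leq uy.
  rewrite /T mulnACA; set p := (\sum_i k i)%N.
  (* Every approximation has at least one piece, so [p] absorbs additive terms in [n]. *)
  have pn : (n <= p)%N.
    by rewrite -[X in (X <= _)%N]card_ord -sum1_card; apply: leq_sum => i _.
  have pE : (\sum_i size (E i) <= 2 * p)%N.
    by rewrite big_distrr /=; apply: leq_sum => i _; have [] := EH i.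
  have L0 : (0 < L)%N by rewrite up_log_gt0.
  (* The two factors: [2 * T0 + n <= 31 * (L * n ^ 2)] and [1 + 2 * (8 * p + n) <= 19 * p]. *)
  apply: leq_mul; last by move: pE; move: (\sum_i size (E i))%N => q; lia.
  by rewrite /T0; nia.
have [T' T'T walk] := reach_walk Pu uv.
apply: (@le_trans _ _ (T'%:R%:E)); first by apply: ereal_inf_lbound; exists T'.
by rewrite lee_fin ler_nat (leq_trans T'T).
Qed.

Theorem corollary4 (R : realType) :
  exists C : R, 0 < C /\
    forall (m n : nat) (A : 'M[R]_(m, n)) (b : 'cV[R]_m),
      (2 <= n)%N -> \rank A = m ->
      (circuit_diameter A b <=
        (C * n%:R ^+ 2 * ln n%:R)%:E *
        ereal_sup [set (\sum_(i < n) SLC (2^-1)%R (max_central_path A b c i))%E |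
                   c in [set c : 'cV[R]_n | max_central_path_defined A b c]])%E.
Proof.
have ln2 : 0 < ln 2 :> R by rewrite ln_gt0 //; lra.
(* The factor [2 / ln 2] converts [up_log 2 n] into [ln n]. *)
exists (31 * 19 * 2 / ln 2); split; first by rewrite divr_gt0 // !mulr_gt0 ?ltr0n.
move=> m n A b n2 _.
have n0 : 0 < n%:R :> R by rewrite ltr0n ltnW.
have lnn : 0 < ln n%:R :> R by rewrite ln_gt0 // ltr1n.
set K := _ * ln n%:R.
have K0 : 0 < K by rewrite !mulr_gt0 ?invr_gt0 ?exprn_gt0.
apply: ge_ereal_sup => _ [[u v] /= [[Pu _] vV] <-].
set c := vertex_cost v.
(* The supremum is at least its term for the cost vector of the target [v]. *)
apply: (@le_trans _ _ (K%:E * \sum_(i < n) SLC 2^-1 (max_central_path A b c i))%E); last first.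
  rewrite lee_pmul2l //; apply: ereal_sup_ubound.
  by exists c => //; exact: vertex_path_defined.
have SLC0 i : (0 <= SLC 2^-1 (max_central_path A b c i))%E.
  by apply: le_ereal_inf_tmp => _ [k _ <-]; rewrite lee_fin.
(* If one complexity is infinite, so is the bound; otherwise all are attained by natural numbers. *)
have [[i0 Hi0]|fin] := pselect (exists i, SLC 2^-1 (max_central_path A b c i) = +oo%E).
  have r0 : (0 <= \sum_(i < n | i != i0) SLC 2^-1 (max_central_path A b c i))%E by exact: sume_ge0.
  by rewrite (bigD1 i0) //= Hi0 addye ?gt0_muley ?leey ?lte_fin // -ltNye (lt_le_trans _ r0).
have /choice[k kH] : forall i, exists k : nat, SLC 2^-1 (max_central_path A b c i) = k%:R%:E /\
   exists psi, [/\ piecewise_linear k psi, forall g, 0 <= g -> 0 <= psi g &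
     forall g, 0 <= g -> 2^-1 * max_central_path A b c i g <= psi g <=
       max_central_path A b c i g].
  move=> i; have [H|[k H1 H2]] := SLC_attained 2^-1 (max_central_path A b c i).
    by exfalso; apply: fin; exists i.
  by exists k.
rewrite (eq_bigr (fun i => (k i)%:R%:E)); last by move=> i _; have [] := kH i.
rewrite sumEFin -natr_sum -EFinM.
apply: le_trans (circuit_dist_bound n2 Pu vV (fun i => proj2 (kH i))) _.
rewrite lee_fin !natrM -expr2 /K; move: (\sum_i k i)%N => p.
have H : (up_log 2 n)%:R <= 2 * ln n%:R / ln 2 :> R by rewrite ler_pdivlMr // up_log_ln.
rewrite (_ : _ * ln n%:R * p%:R = 31 * 19 * (2 * ln n%:R / ln 2 * n%:R ^+ 2 * p%:R)).
  by rewrite ler_pM2l ?mulr_gt0 // ler_wpM2r // ler_wpM2r // exprn_ge0 // ltW.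
by field; rewrite gt_eqF.
Qed.
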